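(* Let $\{X_k\},\{V_k\},\{\mu_k\}$ be generated by the SMPG algorithm with $\bar\mu=0$, and let $\mathbb{K}=\{k\in\mathbb{N}:\|V_k\|_{\mathrm F}\le\mu_k^2\}$. There is a constant $C>0$ depending only on the problem data and on $\mu_0,\theta,\beta$ and the retraction (not on $\epsilon$) such that for every $\epsilon\in(0,1)$ with $\mu_0\ge\epsilon$ there exists an index $k\in\mathbb{K}$ with $k\le C\epsilon^{-3}$ and $\mu_k\le\epsilon$; for any such $k$, $\|V_k\|_{\mathrm F}\le\epsilon^2$ and $X_k$ is an $\epsilon$-approximate stationary point of $\min_{X\in\mathcal{O}^{d,r}}f(X)$, certified by $V=V_k$ and $\mu=\mu_k$.
   Context: Setting. $1\le r<d$, $\mathcal{O}^{d,r}=\{X\in\mathbb{R}^{d\times r}:X^\top X=I_r\}$, $\mathcal{T}_X\mathcal{O}^{d,r}=\{D:X^\top D+D^\top X=0\}$, $\mathrm{Proj}_{\mathcal{T}_X}(V)=V-X(X^\top V+V^\top X)/2$, and $\mathrm{grad}\,F(X)=\mathrm{Proj}_{\mathcal{T}_X}(\nabla F(X))$ for smooth $F$. Problem: $f(X)=u(X)+s(X)+w(X)$, where $u:\mathbb{R}^{d\times r}\to\mathbb{R}$ is continuously differentiable with $L_u$-Lipschitz gradient; $s:\mathbb{R}^{d\times r}\to\mathbb{R}$ is convex and $L_s$-Lipschitz (with convex subdifferential $\partial s$); $w(X)=2\rho\|(I_d-XX^\top)\Sigma_\circ^{1/2}\|_{\mathrm F}$ with $\Sigma_\circ\in\mathbb{S}_+^d$,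 $\rho>0$. Smoothing: $\tilde w(X,\mu)=w(X)$ if $w(X)\ge\mu\rho$, $\tilde w(X,\mu)=\frac{w(X)^2}{2\mu\rho}+\frac{\mu\rho}{2}$ otherwise; $\tilde g(X,\mu)=u(X)+\tilde w(X,\mu)$, $\tilde f(X,\mu)=\tilde g(X,\mu)+s(X)$; $\nabla$ is the Euclidean gradient in $X$ and $\mathrm{grad}\,\tilde w(X,\mu)$ the Riemannian gradient of $\tilde w(\cdot,\mu)$. A point $X\in\mathcal{O}^{d,r}$ is an $\epsilon$-approximate stationary point if there exist $V\in\mathcal{T}_X\mathcal{O}^{d,r}$ with $\|V\|_{\mathrm F}\le\epsilon$ and $\mu\in(0,\epsilon]$ such that $\mathrm{dist}\big(0,\mathrm{grad}\,u(X)+\mathrm{grad}\,\tilde w(X,\mu)+\mathrm{Proj}_{\mathcal{T}_X}(\partial s(X+V))\big)\le\epsilon$. A retraction is a smooth map $\mathfrak{R}$ on the tangent bundle of $\mathcal{O}^{d,r}$ with $\mathfrak{R}_X(0)=X$ and $\mathrm{D}\mathfrak{R}_X(0)=\mathrm{id}$. SMPG algorithm: inputs $X_0\in\mathcal{O}^{d,r}$, $\mu_0>0$, $\bar\mu\in[0,\mu_0]$, $\theta\in(0,1)$, $\beta\in(0,1)$. For $k=0,1,\dots$: compute $V_k=\arg\min_{V\in\mathcal{T}_{X_k}\mathcal{O}^{d,r}}\langle\nabla\tilde g(X_k,\mu_k),V\rangle+\frac{1}{2\mu_k}\|V\|_{\mathrm F}^2+s(X_k+V)$; if $\|V_k\|_{\mathrm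 F}\le\bar\mu^2$ and $\mu_k\le\bar\mu$, stop and return $X_k$; otherwise set $\alpha_k=\beta^{m_k}$ with $m_k$ the smallest nonnegative integer such that $\tilde f(\mathfrak{R}_{X_k}(\beta^{m_k}V_k),\mu_k)\le\tilde f(X_k,\mu_k)-\frac{\beta^{m_k}}{2\mu_k}\|V_k\|_{\mathrm F}^2$, set $X_{k+1}=\mathfrak{R}_{X_k}(\alpha_kV_k)$, and set $\mu_{k+1}=\mu_k$ if $\|V_k\|_{\mathrm F}>\mu_k^2$, $\mu_{k+1}=\theta\mu_k$ if $\|V_k\|_{\mathrm F}\le\mu_k^2$. *)

(* Defs.v *)
From HB Require Import structures.
From mathcomp Require Import all_boot all_order all_algebra.
From mathcomp Require Import all_classical all_reals all_analysis.
Import Order.TTheory GRing.Theory Num.Theory.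
Import numFieldNormedType.Exports.

Set Implicit Arguments.
Unset Strict Implicit.
Unset Printing Implicit Defensive.

Local Open Scope ring_scope.
Local Open Scope classical_set_scope.

Section SMPG.
Variable R : realType.

Definition frob_inner (m n : nat) (A B : 'M[R]_(m, n)) : R :=
  \sum_(i < m) \sum_(j < n) A i j * B i j.
Definition frob (m n : nat) (A : 'M[R]_(m, n)) : R := Num.sqrt (frob_inner A A).

Variables d r : nat.
Local Notation Mat := 'M[R]_(d, r).

Definition stiefel (X : Mat) : Prop := X^T *m X = 1%:M.
Definition tangent (X D : Mat) : Prop := X^T *m D + D^T *m X = 0.
Definition projT (X V : Mat) : Mat := V - 2^-1 *: (X *m (X^T *m V + V^T *m X)).

Definition is_egrad (F : Mat -> R) (G : Mat -> Mat) : Prop :=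
  forall X, differentiable F X /\ ('d F X : Mat -> R) = (fun V => frob_inner (G X) V).

Definition convex_fun (s : Mat -> R) : Prop :=
  forall X Y (t : R), 0 <= t <= 1 ->
    s (t *: X + (1 - t) *: Y) <= t * s X + (1 - t) * s Y.

Definition lipschitz_fun (s : Mat -> R) (L : R) : Prop :=
  forall X Y, `|s X - s Y| <= L * frob (X - Y).

Definition subdiff (s : Mat -> R) (X : Mat) : set Mat :=
  [set G | forall Y, s X + frob_inner G (Y - X) <= s Y].

Definition psd (S : 'M[R]_d) : Prop :=
  S^T = S /\ forall v : 'cV[R]_d, 0 <= (v^T *m S *m v) 0 0.

(* w(X) = 2 rho ||(I - X X^T) Sigma^{1/2}||_F, Sh = Sigma^{1/2} *)
Definition wfun (rho : R) (Sh : 'M[R]_d) (X : Mat) : R :=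
  2 * rho * frob ((1%:M - X *m X^T) *m Sh).

Definition wtil (rho : R) (Sh : 'M[R]_d) (mu : R) (X : Mat) : R :=
  if mu * rho <= wfun rho Sh X then wfun rho Sh X
  else wfun rho Sh X ^+ 2 / (2 * mu * rho) + mu * rho / 2.

Definition dist0 (A : set Mat) : R := inf [set frob Z | Z in A].

Definition iterD (vs : seq (Mat * Mat)) (F : Mat * Mat -> Mat) : Mat * Mat -> Mat :=
  foldr (fun v g => fun p => 'D_v g p) F vs.

Definition smooth_on (U : set (Mat * Mat)) (F : Mat * Mat -> Mat) : Prop :=
  open U /\
  forall (vs : seq (Mat * Mat)) (p : Mat * Mat), U p ->
    {for p, continuous (iterD vs F)} /\ forall v, derivable (iterD vs F) p v.

(* Rt is a retraction: its restriction to the tangent bundle is smooth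
   (expressed as: it is smooth on an open neighbourhood of the tangent
   bundle), maps into the manifold, R_X(0) = X and D R_X(0) = id. *)
Definition retraction (Rt : Mat -> Mat -> Mat) : Prop :=
  (exists U : set (Mat * Mat),
      (forall X D, stiefel X -> tangent X D -> U (X, D)) /\
      smooth_on U (fun p => Rt p.1 p.2)) /\
  (forall X D, stiefel X -> tangent X D -> stiefel (Rt X D)) /\
  (forall X, stiefel X -> Rt X 0 = X) /\
  (forall X D, stiefel X -> tangent X D ->
      'D_((0 : Mat), D) (fun p => Rt p.1 p.2) (X, 0) = D).

Definition ftil (u s : Mat -> R) (rho : R) (Sh : 'M[R]_d) (mu : R) (X : Mat) : R :=
  u X + wtil rho Sh mu X + s X.

Definition eps_stat_cert (gu : Mat -> Mat) (gw : R -> Mat -> Mat) (s : Mat -> R)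
    (eps : R) (X V : Mat) (mu : R) : Prop :=
  tangent X V /\ frob V <= eps /\ 0 < mu <= eps /\
  dist0 [set projT X (gu X) + projT X (gw mu X) + projT X G | G in subdiff s (X + V)]
    <= eps.

Definition eps_stationary (gu : Mat -> Mat) (gw : R -> Mat -> Mat) (s : Mat -> R)
    (eps : R) (X : Mat) : Prop :=
  stiefel X /\ exists V mu, eps_stat_cert gu gw s eps X V mu.

Definition subobj (gu : Mat -> Mat) (gw : R -> Mat -> Mat) (s : Mat -> R)
    (X : Mat) (mu : R) (V : Mat) : R :=
  frob_inner (gu X + gw mu X) V + (2 * mu)^-1 * frob V ^+ 2 + s (X + V).

Definition linecond (u s : Mat -> R) (rho : R) (Sh : 'M[R]_d)
    (Rt : Mat -> Mat -> Mat) (beta : R) (X V : Mat) (mu : R) (m : nat) : Prop :=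
  ftil u s rho Sh mu (Rt X (beta ^+ m *: V))
    <= ftil u s rho Sh mu X - beta ^+ m / (2 * mu) * frob V ^+ 2.

(* (X, V, mus) is the sequence generated by SMPG with bar mu = 0
   (so that the stopping test ||V_k|| <= 0 /\ mu_k <= 0 never fires). *)
Definition smpg_run (u : Mat -> R) (gu : Mat -> Mat) (s : Mat -> R)
    (rho : R) (Sh : 'M[R]_d) (gw : R -> Mat -> Mat)
    (mu0 theta beta : R) (Rt : Mat -> Mat -> Mat)
    (X V : nat -> Mat) (mus : nat -> R) : Prop :=
  stiefel (X 0%N) /\ mus 0%N = mu0 /\
  forall k : nat,
    (tangent (X k) (V k) /\
     forall W, tangent (X k) W -> subobj gu gw s (X k) (mus k) (V k) <= subobj gu gw s (X k) (mus k) W) /\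
    (exists m : nat,
        linecond u s rho Sh Rt beta (X k) (V k) (mus k) m /\
        (forall m', (m' < m)%N -> ~ linecond u s rho Sh Rt beta (X k) (V k) (mus k) m') /\
        X k.+1 = Rt (X k) (beta ^+ m *: V k)) /\
    mus k.+1 = (if mus k ^+ 2 < frob (V k) then mus k else theta * mus k).

End SMPG.

(* Main.v *)
Require Import Defs.
From HB Require Import structures.
From mathcomp Require Import all_boot all_order all_algebra.
From mathcomp Require Import all_classical all_reals all_analysis.
From mathcomp Require Import ring lra.
Import Order.TTheory GRing.Theory Num.Theory.
Import numFieldNormedType.Exports.
Local Open Scope ring_scope.
Local Open Scope classical_set_scope.

Set Implicit Arguments.
Unset Strict Implicit.
Unset Printing Implicit Defensive.

(* The smoothed penalty is [min_(m >= mu rho) (w^2 / (2 m) + m / 2)], hence concave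
   in [w^2], which is polynomial in [X]. So on the Stiefel manifold it has a
   quadratic upper bound with constant [O(1/mu)] and a gradient bounded
   independently of [mu]; consequently [|V_k| = O(mu_k)]. By compactness
   [R_X(D) = X + D + O(|D|^2)] uniformly for bounded tangent [D], so the
   sufficient-decrease test accepts every step below a fixed threshold and the step
   sizes are bounded away from 0. As long as no [k] with [|V_k| <= mu_k^2] and
   [mu_k <= eps] has occurred, [mu_k >= theta eps] and the potential
   [ftil(X_k, mu_k) + mu_k], which is bounded, drops by at least [c eps^3] at
   each iteration. Finally, [V_k] minimises a strongly convex function over the
   tangent space, and Hahn-Banach turns this into a subgradient [G] of [s] at
   [X_k + V_k] whose projected sum with the gradients is [- V_k / mu_k], of norm
   at most [mu_k]. *)

(** * The Frobenius inner product and norm *)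

Section Frobenius.
Context {R : realType}.

Lemma frob_inner_tr m n (A B : 'M[R]_(m, n)) :
  frob_inner A B = \tr (A^T *m B).
Proof.
rewrite /frob_inner /mxtrace exchange_big /=.
apply: eq_bigr => j _; rewrite mxE; apply: eq_bigr => i _.
by rewrite mxE.
Qed.

Lemma frob_inner_trmx m n (A B : 'M[R]_(m, n)) :
  frob_inner A^T B^T = frob_inner A B.
Proof.
rewrite /frob_inner exchange_big /=.
by apply: eq_bigr => i _; apply: eq_bigr => j _; rewrite !mxE.
Qed.

Lemma frob_innerC m n (A B : 'M[R]_(m, n)) : frob_inner A B = frob_inner B A.
Proof. by do 2!apply: eq_bigr => ? _; rewrite mulrC. Qed.

Lemma frob_innerDr m n (A B C : 'M[R]_(m, n)) :
  frob_inner A (B + C) = frob_inner A B + frob_inner A C.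
Proof. by rewrite !frob_inner_tr mulmxDr mxtraceD. Qed.

Lemma frob_innerZr m n (A B : 'M[R]_(m, n)) k :
  frob_inner A (k *: B) = k * frob_inner A B.
Proof. by rewrite !frob_inner_tr -scalemxAr mxtraceZ. Qed.

Lemma frob_innerNr m n (A B : 'M[R]_(m, n)) :
  frob_inner A (- B) = - frob_inner A B.
Proof. by rewrite -scaleN1r frob_innerZr mulN1r. Qed.

Lemma frob_innerBr m n (A B C : 'M[R]_(m, n)) :
  frob_inner A (B - C) = frob_inner A B - frob_inner A C.
Proof. by rewrite frob_innerDr frob_innerNr. Qed.

Lemma frob_innerDl m n (A B C : 'M[R]_(m, n)) :
  frob_inner (A + B) C = frob_inner A C + frob_inner B C.
Proof. by rewrite frob_innerC frob_innerDr !(frob_innerC C). Qed.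

Lemma frob_innerZl m n (A B : 'M[R]_(m, n)) k :
  frob_inner (k *: A) B = k * frob_inner A B.
Proof. by rewrite frob_innerC frob_innerZr frob_innerC. Qed.

Lemma frob_innerNl m n (A B : 'M[R]_(m, n)) :
  frob_inner (- A) B = - frob_inner A B.
Proof. by rewrite frob_innerC frob_innerNr frob_innerC. Qed.

Lemma frob_innerBl m n (A B C : 'M[R]_(m, n)) :
  frob_inner (A - B) C = frob_inner A C - frob_inner B C.
Proof. by rewrite frob_innerDl frob_innerNl. Qed.

Lemma frob_inner_mulmxl m n p (X : 'M[R]_(m, n)) (S : 'M[R]_(n, p)) (D : 'M[R]_(m, p)) :
  frob_inner (X *m S) D = frob_inner S (X^T *m D).
Proof. by rewrite !frob_inner_tr trmx_mul mulmxA. Qed.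

Lemma frob_inner_ge0 m n (A : 'M[R]_(m, n)) : 0 <= frob_inner A A.
Proof. by do 2!apply: sumr_ge0 => ? _; rewrite -expr2 sqr_ge0. Qed.

Lemma frob_sqr m n (A : 'M[R]_(m, n)) : frob A ^+ 2 = frob_inner A A.
Proof. by rewrite /frob sqr_sqrtr // frob_inner_ge0. Qed.

Lemma frob_ge0 m n (A : 'M[R]_(m, n)) : 0 <= frob A.
Proof. exact: sqrtr_ge0. Qed.

Lemma frobZ m n (A : 'M[R]_(m, n)) k : frob (k *: A) = `|k| * frob A.
Proof.
rewrite /frob frob_innerZl frob_innerZr mulrA -expr2 sqrtrM ?sqr_ge0//.
by rewrite sqrtr_sqr.
Qed.

Lemma frobN m n (A : 'M[R]_(m, n)) : frob (- A) = frob A.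
Proof. by rewrite -scaleN1r frobZ normrN1 mul1r. Qed.

Lemma frob0 m n : frob (0 : 'M[R]_(m, n)) = 0.
Proof. by rewrite -(scale0r 0) frobZ normr0 mul0r. Qed.

Lemma frob_trmx m n (A : 'M[R]_(m, n)) : frob A^T = frob A.
Proof. by rewrite /frob frob_inner_trmx. Qed.

Lemma frob_entry m n (A : 'M[R]_(m, n)) i j : `|A i j| <= frob A.
Proof.
rewrite -sqrtr_sqr ler_wsqrtr // /frob_inner (bigD1 i) //= (bigD1 j) //=.
rewrite -expr2 -addrA lerDl addr_ge0 //.
  by apply: sumr_ge0 => ? _; rewrite -expr2 sqr_ge0.
by do 2!apply: sumr_ge0 => ? _; rewrite -expr2 sqr_ge0.
Qed.

Lemma frob_eq0 m n (A : 'M[R]_(m, n)) : frob A = 0 -> A = 0.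
Proof.
move=> A0; apply/matrixP => i j; rewrite mxE; apply/eqP.
by rewrite -normr_le0 -A0 frob_entry.
Qed.

(** Cauchy-Schwarz, from the nonnegative square of [|B| A - |A| B]; zero matrices are split off so
    that the factor [|A| |B|] can be cancelled. *)
Lemma frob_inner_le m n (A B : 'M[R]_(m, n)) :
  frob_inner A B <= frob A * frob B.
Proof.
have [/frob_eq0 ->|A0] := eqVneq (frob A) 0.
  by rewrite frob0 mul0r -(scale0r 0) frob_innerZl mul0r.
have [/frob_eq0 ->|B0] := eqVneq (frob B) 0.
  by rewrite frob0 mulr0 -(scale0r 0) frob_innerZr mul0r.
have Ap : 0 < frob A by rewrite lt_def A0 frob_ge0.
have Bp : 0 < frob B by rewrite lt_def B0 frob_ge0.
have := frob_inner_ge0 (frob B *: A - frob A *: B).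
rewrite frob_innerBl !frob_innerBr !(frob_innerZl, frob_innerZr).
rewrite (frob_innerC B A) -!frob_sqr => h.
rewrite -(ler_pM2l (mulr_gt0 Ap Bp)); move: h; nra.
Qed.

Lemma normr_frob_inner m n (A B : 'M[R]_(m, n)) :
  `|frob_inner A B| <= frob A * frob B.
Proof.
rewrite ler_norml frob_inner_le andbT lerNl -frob_innerNl.
by rewrite (le_trans (frob_inner_le _ _)) // frobN.
Qed.

Lemma frobD m n (A B : 'M[R]_(m, n)) : frob (A + B) <= frob A + frob B.
Proof.
rewrite -(@ler_pXn2r _ 2) ?nnegrE ?addr_ge0 ?frob_ge0 //.
rewrite frob_sqr frob_innerDl !frob_innerDr (frob_innerC B A) -!frob_sqr.
have := frob_inner_le A B; rewrite sqrrD; lra.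
Qed.

Lemma frobB m n (A B : 'M[R]_(m, n)) : frob (A - B) <= frob A + frob B.
Proof. by rewrite -(frobN B) frobD. Qed.

(** An entry of the product pairs a row of [A] with a column of [B]: Cauchy-Schwarz bounds its
    square, and the bounds are summed. *)
Lemma frobM m n p (A : 'M[R]_(m, n)) (B : 'M[R]_(n, p)) :
  frob (A *m B) <= frob A * frob B.
Proof.
rewrite -(@ler_pXn2r _ 2) ?nnegrE ?mulr_ge0 ?frob_ge0 //.
rewrite exprMn -(frob_trmx B) !frob_sqr /frob_inner.
rewrite [leRHS]mulr_suml; apply: ler_sum => i _.
rewrite [leRHS]mulr_sumr; apply: ler_sum => j _.
have h : frob_inner (row i A) (row j B^T) ^+ 2
    <= (frob (row i A) * frob (row j B^T)) ^+ 2.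
  rewrite -[leLHS]real_normK ?num_real //.
  by rewrite ler_pXn2r ?nnegrE ?mulr_ge0 ?frob_ge0 ?normr_frob_inner.
move: h; rewrite exprMn !frob_sqr /frob_inner !big_ord1 -expr2 mxE.
under eq_bigr do rewrite !mxE.
under [X in _ <= X * _]eq_bigr do rewrite !mxE.
move=> h; apply: (le_trans h); apply: ler_wpM2l.
  by apply: sumr_ge0 => k _; rewrite -expr2 sqr_ge0.
by apply: ler_sum => k _; rewrite !mxE.
Qed.

(** Triangle inequality on the expansion in elementary matrices, each of norm at most 1. *)
Lemma frob_le_sum m n (A : 'M[R]_(m, n)) : frob A <= \sum_i \sum_j `|A i j|.
Proof.
rewrite [X in frob X]matrix_sum_delta.
have fs (I : finType) (F : I -> 'M[R]_(m, n)) :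
    frob (\sum_i F i) <= \sum_i frob (F i).
  apply: (big_ind2 (fun (x : 'M[R]_(m, n)) y => frob x <= y)); rewrite ?frob0 //.
  by move=> x1 x2 y1 y2 h1 h2; rewrite (le_trans (frobD _ _)) ?lerD.
rewrite (le_trans (fs _ _)) //; apply: ler_sum => i _.
rewrite (le_trans (fs _ _)) //; apply: ler_sum => j _.
rewrite frobZ ler_piMr // /frob /frob_inner (bigD1 i) //= (bigD1 j) //=.
rewrite !mxE !eqxx mulr1 big1 => [|k kj]; last by rewrite !mxE (negbTE kj) andbF mulr0.
rewrite big1 => [|k ki]; first by rewrite !addr0 sqrtr1.
by rewrite big1 // => l _; rewrite !mxE (negbTE ki) mulr0.
Qed.

Lemma mx_norm_entry m n (A : 'M[R]_(m, n)) i j : `|A i j| <= `|A|.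
Proof.
by rewrite [leRHS]/Num.Def.normr/= mx_normrE; exact: (le_bigmax _ _ (i, j)).
Qed.

Lemma mx_norm_le m n (A : 'M[R]_(m, n)) M :
  0 <= M -> (forall i j, `|A i j| <= M) -> `|A| <= M.
Proof.
by move=> M0 AM; rewrite [leLHS]/Num.Def.normr/= mx_normrE bigmax_le.
Qed.

End Frobenius.

(** * Mean value and Taylor estimates along directions *)

Section DirectionalDerivatives.
Context {R : realType} {V : normedModType R}.
Implicit Types (g : V -> R) (p v : V).

Lemma is_derive_line g p v t : derivable g (p + t *: v) v ->
  is_derive t 1 (fun h => g (p + h *: v)) ('D_v g (p + t *: v)).
Proof.
move=> gv.
have E : (fun h => h^-1 *: (((fun h0 => g (p + h0 *: v)) \o shift t) (h *: 1) - g (p + t *: v)))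
   = (fun h => h^-1 *: ((g \o shift (p + t *: v)) (h *: v) - g (p + t *: v))).
  apply/funext => h /=; congr (_ *: (g _ - _)).
  by rewrite addrCA -scalerDl [h *: 1]mulr1.
by split; rewrite /derivable /derive E.
Qed.

Lemma mvt_line g p v (c : R) :
  (forall t : R, `|t| <= `|c| -> derivable g (p + t *: v) v) ->
  exists2 t : R, `|t| <= `|c| & g (p + c *: v) - g p = c * 'D_v g (p + t *: v).
Proof.
move=> gv.
have dg (t : R) : `|t| <= `|c| ->
    is_derive t 1 (fun h => g (p + h *: v)) ('D_v g (p + t *: v)).
  by move=> /gv; exact: is_derive_line.
have [c0|/ltW c0] := leP 0 c.
  have cE (t : R) : t \in `[0, c]%R -> `|t| <= `|c|.
    by rewrite in_itv /= => /andP[t0 tc]; rewrite !ger0_norm.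
  have [t tc h] := @MVT_segment R _ (fun t => 'D_v g (p + t *: v)) _ _ c0
    (fun t tc => dg t (cE t (subset_itv_oo_cc tc)))
    (derivable_within_continuous (fun t tc => @ex_derive _ _ _ _ _ _ _ (dg t (cE t tc)))).
  by exists t; [exact: cE|move: h; rewrite scale0r addr0 subr0 mulrC].
have cE (t : R) : t \in `[c, 0]%R -> `|t| <= `|c|.
  by rewrite in_itv /= => /andP[t0 tc]; rewrite !ler0_norm // lerN2.
have [t tc h] := @MVT_segment R _ (fun t => 'D_v g (p + t *: v)) _ _ c0
  (fun t tc => dg t (cE t (subset_itv_oo_cc tc)))
  (derivable_within_continuous (fun t tc => @ex_derive _ _ _ _ _ _ _ (dg t (cE t tc)))).
exists t; first exact: cE.
move: h; rewrite scale0r addr0 sub0r => /eqP.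
by rewrite -opprB mulrN eqr_opp => /eqP ->; rewrite mulrC.
Qed.

(** Positive [t] suffice because the derivative is assumed to exist; after division by [t] the
    quadratic term tends to 0. *)
Lemma derive_le_quad g p v (a b e : R) : 0 < e -> derivable g p v ->
  (forall t : R, 0 < t < e -> g (p + t *: v) <= g p + t * a + t ^+ 2 * b) ->
  'D_v g p <= a.
Proof.
move=> e0 gv gle; apply/ler_addgt0Pr => x x0.
have gd : h^-1 *: ((g \o shift p) (h *: v) - g p) @[h --> 0^'] --> 'D_v g p := gv.
have := gd => /cvgrPdist_lt /(_ _ (divr_gt0 x0 (ltr0n _ 2))) [d /= d0 dP].
(* Below [d], where the quotient is within [x / 2] of the derivative; below [e], where the bound
   holds; and small enough that [t * b <= x / 2]. *)
pose t := Num.min (d / 2) (Num.min (e / 2) (x / (2 * (`|b| + 1)))).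
have b1 : 0 < `|b| + 1 by rewrite ltr_wpDl.
have t0 : 0 < t by rewrite !lt_min !divr_gt0 //= mulr_gt0.
have td : t < d by rewrite gt_min ltr_pdivrMr // ltr_pMr // ltr1n.
have te : t < e by rewrite !gt_min [e / 2 < e]ltr_pdivrMr // ltr_pMr // ltr1n orbT.
have tb : t * b <= x / 2.
  have : t <= x / (2 * (`|b| + 1)) by rewrite !ge_min lexx !orbT.
  rewrite ler_pdivlMr ?mulr_gt0 // => tx.
  have := ler_norm b; have := normr_ge0 b; nra.
have := dP t; rewrite /ball_ /= sub0r normrN gtr0_norm // => /(_ td (lt0r_neq0 t0)).
have := gle t; rewrite t0 te => /(_ isT).
rewrite /= [t *: v + p]addrC -lerBlDl opprD => gt /ltr_distlDr.
set q := t^-1 *: _.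
suff qab : q <= a + t * b by move=> qD; lra.
rewrite /q [_ *: _]mulrC ler_pdivrMr //; lra.
Qed.

Lemma derive_eq_quad g p v (a b e : R) : 0 < e -> derivable g p v ->
  (forall t : R, 0 < t < e -> `|g (p + t *: v) - g p - t * a| <= t ^+ 2 * b) ->
  'D_v g p = a.
Proof.
move=> e0 gv gE; apply/eqP; rewrite eq_le; apply/andP; split.
  apply: (derive_le_quad (b := b) e0 gv) => t /gE; rewrite ler_norml => /andP[_].
  by move=> h; rewrite -[leRHS]addrA -!lerBlDl.
rewrite -lerN2 -deriveN //.
apply: (derive_le_quad (b := b) e0 (derivableN gv)) => t /gE.
rewrite ler_norml => /andP[+ _].
rewrite lerNl !opprD !opprK => h.
by rewrite mulrN -[leRHS]addrA -!lerBlDl !opprK.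
Qed.

(* Telescoping along the directions [v i]; the reference values [k i] for the
   partial derivatives let the same estimate serve both as a Lipschitz bound
   ([k = 0]) and as a first-order Taylor bound. *)
Lemma partials_expansion (I : Type) (l : seq I) (c k : I -> R) (v : I -> V)
    g p M : 0 <= M ->
  (forall i q, `|q - p| <= \sum_(j <- l) `|c j| * `|v j| ->
     derivable g q (v i) /\ `|'D_(v i) g q - k i| <= M) ->
  `|g (p + \sum_(i <- l) c i *: v i) - g p - \sum_(i <- l) c i * k i|
    <= M * \sum_(i <- l) `|c i|.
Proof.
move=> M0; elim: l p => [|i l IH] p gP.
  by rewrite !big_nil addr0 subrr subr0 normr0 mulr0.
rewrite !big_cons in gP *.
have S0 : 0 <= \sum_(j <- l) `|c j| * `|v j|.
  by apply: sumr_ge0 => j _; rewrite mulr_ge0.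
have gl (t : R) : `|t| <= `|c i| -> derivable g (p + t *: v i) (v i) /\
    `|'D_(v i) g (p + t *: v i) - k i| <= M.
  move=> tc; apply: gP; rewrite addrAC subrr add0r normrZ.
  by rewrite (le_trans (ler_wpM2r _ tc)) // lerDl.
have [t tc gE] := mvt_line (fun t tc => (gl t tc).1).
have {IH} := IH (p + c i *: v i).
set G := g (p + c i *: v i) in gE *.
have -> : p + (c i *: v i + \sum_(j <- l) c j *: v j) =
  p + c i *: v i + \sum_(j <- l) c j *: v j by rewrite addrA.
move=> IH.
have {}IH := IH _.
set F := g (_ + _) in IH *.
have -> : F - g p - (c i * k i + \sum_(j <- l) c j * k j) =
  (F - G - \sum_(j <- l) c j * k j) + (c i * ('D_(v i) g (p + t *: v i) - k i)).
  by rewrite mulrBr -gE; ring.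
rewrite (le_trans (ler_normD _ _)) // [leRHS]mulrDr [leRHS]addrC; apply: lerD.
  apply: IH => j q qp; apply: gP.
  have -> : q - p = (q - (p + c i *: v i)) + c i *: v i by rewrite opprD addrA addrNK.
  by rewrite (le_trans (ler_normD _ _)) // [X in _ <= X]addrC lerD // normrZ.
by rewrite normrM mulrC ler_wpM2r // (gl t tc).2.
Qed.

End DirectionalDerivatives.

(** * Finite-dimensional Hahn-Banach theorem under a convex majorant *)

Section HahnBanach.
Context {R : realType}.

Definition convex_on (V : lmodType R) (p : V -> R) := forall x y (t : R),
  0 <= t <= 1 -> p (t *: x + (1 - t) *: y) <= t * p x + (1 - t) * p y.

(* The slopes of [p] seen from the two sides of [U] along [v] are separated by
   convexity; [c] is any number between them. *)
Lemma hahn_banach_slope (V : vectType R) (p : V -> R) (U : {vspace V})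
    (f : 'Hom(V, R^o)) (v : V) : convex_on p ->
  (forall w, w \in U -> f w <= p w) ->
  exists c : R, forall w t, w \in U -> f w + t * c <= p (w + t *: v).
Proof.
move=> pc fp.
have key w w' (t t' : R) : w \in U -> w' \in U -> 0 < t -> 0 < t' ->
    (f w - p (w - t *: v)) / t <= (p (w' + t' *: v) - f w') / t'.
  move=> wU w'U t0 t'0; rewrite ler_pdivrMr // mulrAC ler_pdivlMr //.
  have tt0 : 0 < t + t' by rewrite addr_gt0.
  (* With these weights the multiples of [v] cancel in the convex combination, which therefore lies
     in [U], where [f <= p]. *)
  pose l := t' / (t + t').
  have l01 : 0 <= l <= 1.
    apply/andP; split; first by apply: divr_ge0; exact: ltW.
    by rewrite /l ler_pdivrMr // mul1r lerDr ltW.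
  have l1E : 1 - l = t / (t + t').
    by rewrite /l; field; exact: lt0r_neq0.
  have := pc (w - t *: v) (w' + t' *: v) l l01.
  have -> : l *: (w - t *: v) + (1 - l) *: (w' + t' *: v) = l *: w + (1 - l) *: w'.
    rewrite scalerBr scalerDr addrACA !scalerA -[RHS]addr0; congr (_ + _).
    rewrite -scaleNr -scalerDl l1E /l.
    have -> : - (t' / (t + t') * t) + t / (t + t') * t' = 0 by ring.
    by rewrite scale0r.
  have := fp (l *: w + (1 - l) *: w').
  rewrite rpredD ?rpredZ // => /(_ isT).
  have -> : f (l *: w + (1 - l) *: w') = l * f w + (1 - l) * f w' by rewrite linearP linearZ.
  move=> h1 h2; have {h1 h2} := le_trans h1 h2.
  rewrite l1E /l.
  move=> h; have {h} := ler_wpM2l (ltW tt0) h.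
  have E a b : (t + t') * (t' / (t + t') * a + t / (t + t') * b) = t' * a + t * b.
    by field; exact: lt0r_neq0.
  by rewrite !E; lra.
pose A : set R := [set x | exists w t, [/\ w \in U, 0 < t & x = (f w - p (w - t *: v)) / t]].
have A0 : A !=set0.
  exists ((f 0 - p (0 - 1 *: v)) / 1), 0, 1; split=> //; exact: mem0v.
have ubA w t : w \in U -> 0 < t -> ubound A ((p (w + t *: v) - f w) / t).
  by move=> wU t0 _ [w' [t' [w'U t'0 ->]]]; exact: key.
have hA : has_sup A.
  by split=> //; exists ((p (0 + 1 *: v) - f 0) / 1); apply: ubA => //; exact: mem0v.
exists (sup A) => w t wU.
(* For [t < 0] the slope at [- t] belongs to [A]; for [t > 0] the right slope is an upper bound of
   [A]; [t = 0] is the hypothesis on [U]. *)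
have [t0|t0|->] := ltgtP t 0.
- have := ub_le_sup hA.2 (ex_intro _ w (ex_intro _ (- t) (And3 wU _ erefl))).
  rewrite oppr_gt0 t0 => /(_ isT); rewrite scaleNr opprK.
  by rewrite ler_pdivrMr ?oppr_gt0 //; lra.
- have := ge_sup A0 (ubA _ _ wU t0).
  by rewrite ler_pdivlMr //; lra.
- by rewrite mul0r addr0 scale0r addr0 fp.
Qed.

(** Induction on the codimension of [U]: each round adds one vector [v] outside [U], on which the
    form takes the value given by [hahn_banach_slope]. *)
Lemma hahn_banach (V : vectType R) (p : V -> R) (U : {vspace V})
    (f : 'Hom(V, R^o)) : convex_on p ->
  (forall w, w \in U -> f w <= p w) ->
  exists g : 'Hom(V, R^o),
    (forall w, w \in U -> g w = f w) /\ (forall w, g w <= p w).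
Proof.
move=> pc; have [n] := ubnP (\dim {:V} - \dim U).
elim: n U f => // n IH U f; rewrite ltnS => dn fp.
have [UE|/eqP UV] := eqVneq U {:V}%VS.
  by rewrite UE in fp *; exists f; split=> // w; rewrite fp // memvf.
have [v _ vU] : exists2 v, v \in fullv & v \notin U.
  by apply/subvPn; apply: contra_notN UV => UV; apply/eqP; rewrite eqEsubv subvf.
have [c cP] := hahn_banach_slope v pc fp.
have vU0 : (U :&: <[v]> = 0)%VS.
  apply/eqP; rewrite -subv0; apply/subvP => x; rewrite memv_cap.
  move=> /andP[xU /vlineP[k xE]]; rewrite memv0 xE.
  have [->|k0] := eqVneq k 0; first by rewrite scale0r.
  by move: vU; rewrite -(scale1r v) -(mulVf k0) -scalerA -xE rpredZ.
have v0 : v != 0 by apply: contraNneq vU => ->; exact: mem0v.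
pose h : 'Hom(V, R^o) := linfun (coord [tuple v] ord0).
have hv t : h (t *: v) = t.
  have c1 : coord [tuple v] ord0 v = 1.
    by rewrite (coord_free (X := [tuple v]) ord0 ord0) ?eqxx // seq1_free.
  by rewrite lfunE linearZ /= c1; exact: mulr1.
pose piU := daddv_pi U <[v]>; pose piv := daddv_pi <[v]> U.
have piE w : w \in (U + <[v]>)%VS -> piU w + piv w = w by exact: daddv_pi_add.
(* The projections of the direct sum [U + <[v]>] make this the form sending [w + t *: v] to
   [f w + t * c] for [w] in [U]. *)
pose g : 'Hom(V, R^o) := ((f \o piU) + c *: (h \o piv))%VF.
have gE w : g w = f (piU w) + c * h (piv w) by rewrite add_lfunE scale_lfunE !comp_lfunE.
have gp w : w \in (U + <[v]>)%VS -> g w <= p w.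
  move=> /piE wE; rewrite -[in leRHS]wE gE.
  have /vlineP[t tE] : piv w \in <[v]>%VS by exact: memv_pi.
  by rewrite tE hv mulrC cP // memv_pi.
have gU w : w \in U -> g w = f w.
  move=> wU; have piUw : piU w = w by exact: daddv_pi_id.
  have : piU w + piv w = w by apply: piE; apply: subvP wU; exact: addvSl.
  rewrite piUw -[RHS]addr0 => /addrI pivw.
  by rewrite gE piUw pivw linear0 mulr0 addr0.
have UW : (\dim U < \dim (U + <[v]>)%VS)%N.
  by rewrite dimv_disjoint_sum // dim_vline v0 addn1.
have dW := dimvS (subvf (U + <[v]>)%VS).
have [|k [kU kp]] := IH (U + <[v]>)%VS g _ gp.
  by apply: leq_trans dn; rewrite ltn_sub2l // (leq_trans UW).
exists k; split=> // w wU; rewrite kU ?gU //.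
by apply: subvP wU; exact: addvSl.
Qed.

End HahnBanach.

(** * Tangent spaces of the Stiefel manifold and optimality of the proximal step *)

Section TangentSpace.
Context {R : realType} {d r : nat}.
Local Notation Mat := 'M[R]_(d, r).
Implicit Types (X D H : Mat).

Lemma tangentZ X D k : tangent X D -> tangent X (k *: D).
Proof.
rewrite /tangent => XD.
by rewrite [(k *: D)^T]linearZ /= -scalemxAr -scalemxAl -scalerDr XD scaler0.
Qed.

Lemma tangentD X D1 D2 : tangent X D1 -> tangent X D2 -> tangent X (D1 + D2).
Proof.
rewrite /tangent => XD1 XD2.
by rewrite [(D1 + D2)^T]linearD /= mulmxDr mulmxDl addrACA XD1 XD2 addr0.
Qed.

Lemma tangent0 X : tangent X 0.
Proof. by rewrite /tangent trmx0 mulmx0 mul0mx addr0. Qed.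

Lemma projT_is_linear X : linear (projT X).
Proof.
move=> k A B; pose S (H : Mat) := X^T *m H + H^T *m X.
have SE : S (k *: A + B) = k *: S A + S B.
  rewrite /S [(k *: A + B)^T]linearP /= mulmxDr mulmxDl -scalemxAr -scalemxAl.
  by rewrite addrACA -scalerDr.
rewrite /projT -!/(S _) SE mulmxDr -scalemxAr scalerDr opprD addrACA.
by rewrite scalerBr !scalerA mulrC.
Qed.

Lemma projT_id X D : tangent X D -> projT X D = D.
Proof. by rewrite /tangent /projT => ->; rewrite mulmx0 scaler0 subr0. Qed.

Lemma projT_tangent X H : stiefel X -> tangent X (projT X H).
Proof.
rewrite /stiefel /tangent /projT => XX; set S := X^T *m H + H^T *m X.
have ST : S^T = S by rewrite /S linearD /= !trmx_mul !trmxK addrC.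
rewrite [(H - _)^T]linearB /= [(_ *: _)^T]linearZ /= trmx_mul ST mulmxBr mulmxBl.
rewrite -scalemxAr -scalemxAl mulmxA XX mul1mx -mulmxA XX mulmx1.
have h2 : 2^-1 + 2^-1 = 1 :> R by lra.
by rewrite addrACA -/S -opprD -scalerDl h2 scale1r subrr.
Qed.

(** The removed part is [X] times a symmetric matrix, whose pairing with [D] is that of the
    symmetric matrix with [X^T *m D]. The latter is skew for tangent [D], so the pairing
    vanishes. *)
Lemma projT_orth X H D : tangent X D -> frob_inner (H - projT X H) D = 0.
Proof.
rewrite /tangent /projT subKr => XD.
rewrite frob_innerZl frob_inner_mulmxl; set S := _ + _; set K := X^T *m D.
have ST : S^T = S by rewrite /S linearD /= !trmx_mul !trmxK addrC.
have KT : K^T = - K.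
  by apply/eqP; rewrite -addr_eq0 addrC trmx_mul trmxK XD.
have := frob_inner_trmx S K; rewrite ST KT frob_innerNr => h.
by rewrite (_ : frob_inner S K = 0) ?mulr0 //; lra.
Qed.

Lemma projT_eq0 X H : stiefel X ->
  (forall D, tangent X D -> frob_inner H D = 0) -> projT X H = 0.
Proof.
move=> XX H0; apply: frob_eq0; apply/eqP; rewrite -sqrf_eq0 frob_sqr.
have T := projT_tangent H XX.
by rewrite -[X in frob_inner X _](subKr H) frob_innerBl H0 // projT_orth // subr0.
Qed.

(** The tangent space as the kernel of a linear map, the form in which Hahn-Banach takes its
    subspace. *)
Lemma tangent_vspace X : exists U : {vspace Mat}, forall D, D \in U <-> tangent X D.
Proof.
pose F : Mat -> 'M[R]_r := fun D => X^T *m D + D^T *m X.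
have Flin : linear F.
  move=> k A B; rewrite /F [(k *: A + B)^T]linearP /= mulmxDr mulmxDl.
  by rewrite -scalemxAr -scalemxAl addrACA -scalerDr.
pose F' : {linear Mat -> 'M[R]_r} := HB.pack F (GRing.isLinear.Build _ _ _ _ F Flin).
exists (lker (linfun F')) => D; rewrite memv_ker lfunE /=.
by split=> [/eqP|/eqP].
Qed.

(* Compare [V] with [V + t W], divide by [t] and let [t] tend to 0. *)
Lemma prox_variational (s : Mat -> R) X V a (mu : R) : convex_fun s ->
  0 < mu -> tangent X V ->
  (forall W, tangent X W ->
     frob_inner a V + (2 * mu)^-1 * frob V ^+ 2 + s (X + V)
     <= frob_inner a W + (2 * mu)^-1 * frob W ^+ 2 + s (X + W)) ->
  forall W, tangent X W ->
    0 <= frob_inner (a + mu^-1 *: V) W + s (X + V + W) - s (X + V).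
Proof.
move=> sc mu0 XV Vmin W XW.
set q := _ - _.
pose b := (2 * mu)^-1 * frob W ^+ 2.
have b0 : 0 <= b by rewrite mulr_ge0 ?sqr_ge0 // invr_ge0 mulr_ge0 // ltW.
have h (t : R) : 0 < t <= 1 -> 0 <= q + t * b.
  move=> /andP[t0 t1].
  have := Vmin (V + t *: W) (tangentD XV (tangentZ t XW)).
  have : s (X + (V + t *: W)) <= t * s (X + V + W) + (1 - t) * s (X + V).
    have := sc (X + V + W) (X + V) t; rewrite t1 ltW // => /(_ isT).
    rewrite scalerDr addrAC -scalerDl addrCA subrr addr0 scale1r.
    by rewrite addrA.
  rewrite !frob_sqr !frob_innerDr !frob_innerDl !frob_innerZr !frob_innerZl.
  rewrite (frob_innerC W V).
  rewrite -(pmulr_rge0 _ t0) /q /b !frob_innerDl frob_innerZl frob_sqr.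
  have -> : mu^-1 = 2 * (2 * mu)^-1 by field; exact: lt0r_neq0.
  lra.
rewrite leNgt; apply/negP => q0.
have b1 : 0 < b + 1 by rewrite ltr_wpDl.
(* If [q < 0], this choice gives [t * b <= - q / 2], so that [q + t * b] is negative, against
   [h]. *)
pose t := Num.min 1 (- q / (2 * (b + 1))).
have t0 : 0 < t by rewrite lt_min ltr01 divr_gt0 ?mulr_gt0 // oppr_gt0.
have := h t; rewrite t0 ge_min lexx => /(_ isT).
have : t <= - q / (2 * (b + 1)) by rewrite ge_min lexx orbT.
rewrite ler_pdivlMr ?mulr_gt0 //; nra.
Qed.

(** By [prox_variational], on the tangent space the form [- <a + V / mu, W>] lies below the convex
    increment [s (X + V + W) - s (X + V)]. A Hahn-Banach extension that stays below it everywhere is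
    a subgradient, and agreement on tangent directions is the projected equation. *)
Lemma prox_subgradient (s : Mat -> R) X V a (mu : R) : convex_fun s ->
  0 < mu -> stiefel X -> tangent X V ->
  (forall W, tangent X W ->
     frob_inner a V + (2 * mu)^-1 * frob V ^+ 2 + s (X + V)
     <= frob_inner a W + (2 * mu)^-1 * frob W ^+ 2 + s (X + W)) ->
  exists2 G, subdiff s (X + V) G & projT X a + projT X G = - (mu^-1 *: V).
Proof.
move=> sc mu0 XX XV Vmin.
have var := prox_variational sc mu0 XV Vmin.
have [U UP] := tangent_vspace X.
have [Z ZE] : exists Z, Z = X + V by exists (X + V).
pose A := - (a + mu^-1 *: V).
pose p (W : Mat) := s (Z + W) - s Z.
have pc : convex_on p.
  move=> x y t t01; have := sc (Z + x) (Z + y) t t01.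
  have t1 : t + (1 - t) = 1 by lra.
  by rewrite !scalerDr addrACA -scalerDl t1 scale1r /p; lra.
have fl : linear (fun W : Mat => frob_inner A W : R^o).
  by move=> k B C; rewrite frob_innerDr frob_innerZr.
pose f : {linear Mat -> R^o} := HB.pack (fun W : Mat => frob_inner A W : R^o)
  (GRing.isLinear.Build _ _ _ _ (fun W : Mat => frob_inner A W : R^o) fl).
have fp w : w \in U -> linfun f w <= p w.
  move=> /UP Xw; rewrite lfunE /= /A frob_innerNl.
  by have := var w Xw; rewrite /p ZE; lra.
have [g [gU gp]] := hahn_banach pc fp.
(* The matrix representing the form [g] for the Frobenius product. *)
pose G : Mat := \matrix_(i, j) g (delta_mx i j).
have gE W : g W = frob_inner G W.
  rewrite [in LHS](matrix_sum_delta W) linear_sum; apply: eq_bigr => i _.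
  rewrite linear_sum; apply: eq_bigr => j _.
  by rewrite linearZ mxE mulrC.
exists G.
  move=> Y; have := gp (Y - (X + V)).
  by rewrite gE /p ZE addrCA subrr addr0; lra.
have : projT X (a + mu^-1 *: V + G) = 0.
  apply: projT_eq0 => // D XD; have := gU D ((UP D).2 XD).
  rewrite gE lfunE /= /A frob_innerNl !frob_innerDl => ->; exact: addrN.
have PD B C : projT X (B + C) = projT X B + projT X C.
  by have := projT_is_linear X 1 B C; rewrite !scale1r.
rewrite !PD (projT_id (tangentZ _ XV)) addrAC => /eqP.
by rewrite addr_eq0 => /eqP.
Qed.

End TangentSpace.

(** * The smoothed penalty: concavity in [w ^+ 2] and quadratic upper bounds *)

Section PenaltySmoothing.
Context {R : realType}.
Implicit Types (rho mu c m w : R).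

(* As a function of the square of [w] this is concave: it equals
   [min_(m >= c) (w ^+ 2 / (2 * m) + m / 2)], attained at [m = max w c]. *)
Definition huber c w : R := if c <= w then w else w ^+ 2 / (2 * c) + c / 2.

(** For [c <= w] the gap is [(w - m) ^+ 2 / (2 * m)]; otherwise it factors through [m - c] and
    [c * m - w ^+ 2], both nonnegative. *)
Lemma huber_le c w m : 0 < c -> 0 <= w -> c <= m ->
  huber c w <= w ^+ 2 / (2 * m) + m / 2.
Proof.
move=> c0 w0 cm; have m0 : 0 < m by exact: lt_le_trans cm.
rewrite /huber; have [_|wc] := leP c w.
  have -> : w ^+ 2 / (2 * m) + m / 2 = w + (w - m) ^+ 2 / (2 * m).
    by field; exact: lt0r_neq0.
  by rewrite lerDl divr_ge0 ?sqr_ge0 // ltW // mulr_gt0.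
rewrite -subr_ge0.
have -> : w ^+ 2 / (2 * m) + m / 2 - (w ^+ 2 / (2 * c) + c / 2)
    = (m - c) * (c * m - w ^+ 2) / (2 * (c * m)).
  by field; rewrite !lt0r_neq0.
rewrite divr_ge0 // mulr_ge0 ?subr_ge0 //; last by rewrite mulr_ge0 ?ltW.
by rewrite expr2; apply: ler_pM => //; [exact: ltW|apply: le_trans cm; exact: ltW].
Qed.

Lemma huber_max c w : 0 < c -> 0 <= w ->
  huber c w = w ^+ 2 / (2 * Num.max w c) + Num.max w c / 2.
Proof.
move=> c0 w0; rewrite /huber; have [cw|wc] := leP c w.
  by field; apply: lt0r_neq0; exact: lt_le_trans cw.
by [].
Qed.

(** The minimiser [m = max w c] belonging to [w] is admissible for [w1] too; freezing it gives a
    supporting line in the variable [w ^+ 2]. *)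
Lemma huber_concave c w w1 : 0 < c -> 0 <= w -> 0 <= w1 ->
  huber c w1 <= huber c w + (w1 ^+ 2 - w ^+ 2) / (2 * Num.max w c).
Proof.
move=> c0 w0 w10; rewrite [huber c w]huber_max //.
have cm : c <= Num.max w c by rewrite le_max lexx orbT.
have := huber_le c0 w10 cm; rewrite mulrBl; lra.
Qed.

(** A larger [c] leaves fewer [m] to minimise over. *)
Lemma huber_mono c c1 w : 0 < c -> c <= c1 -> 0 <= w -> huber c w <= huber c1 w.
Proof.
move=> c0 cc1 w0; rewrite [leRHS]huber_max //; last exact: lt_le_trans cc1.
by apply: huber_le => //; rewrite le_max cc1 orbT.
Qed.

Lemma huber_ge0 c w : 0 < c -> 0 <= w -> 0 <= huber c w.
Proof.
move=> c0 w0; rewrite /huber; case: ifP => // _.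
by rewrite addr_ge0 // divr_ge0 ?sqr_ge0 ?mulr_ge0 // ltW.
Qed.

Lemma huber_upper c w : 0 < c -> 0 <= w -> huber c w <= w + c.
Proof.
move=> c0 w0; rewrite /huber; have [_|wc] := leP c w; first by rewrite lerDl ltW.
suff : w ^+ 2 / (2 * c) <= w by lra.
by rewrite ler_pdivrMr ?mulr_gt0 // expr2 ler_wpM2l //; lra.
Qed.

Variables (d r : nat).
Local Notation Mat := 'M[R]_(d, r).
Implicit Types (X Y H : Mat).

Lemma wtil_huber rho (Sh : 'M[R]_d) mu X :
  wtil rho Sh mu X = huber (mu * rho) (wfun rho Sh X).
Proof. by rewrite /wtil /huber mulrA. Qed.

Lemma wfun_ge0 rho (Sh : 'M[R]_d) X : 0 < rho -> 0 <= wfun rho Sh X.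
Proof. by move=> rho0; rewrite mulr_ge0 ?frob_ge0 // mulr_ge0 // ltW. Qed.

Lemma frob_stiefel X : stiefel X -> frob X = Num.sqrt r%:R.
Proof. by rewrite /stiefel /frob frob_inner_tr => ->; rewrite mxtrace_scalar. Qed.

(** The matrix at [X + H] is [A - (B + Q)] with [B] linear and [Q] quadratic in [H]. The square has
    linear part [- 2 <A, B>]; since [|H| <= b], [B + Q] is at most a multiple of [|H|], so the rest
    is of order [|H|^2]. *)
Lemma wfun_sqr_expand rho (Sh : 'M[R]_d) X H b A B : frob H <= b ->
  A = (1%:M - X *m X^T) *m Sh -> B = (X *m H^T + H *m X^T) *m Sh ->
  wfun rho Sh (X + H) ^+ 2 <= wfun rho Sh X ^+ 2 - 8 * rho ^+ 2 * frob_inner A B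
    + 4 * rho ^+ 2 * (((2 * frob X + b) * frob Sh) ^+ 2
        + 2 * frob A * frob Sh) * frob H ^+ 2.
Proof.
move=> Hb Adef Bdef; pose Q := (H *m H^T) *m Sh.
have h0 := frob_ge0 H; have s0 := frob_ge0 Sh; have x0 := frob_ge0 X.
have AE : (1%:M - (X + H) *m (X + H)^T) *m Sh = A - (B + Q).
  rewrite Adef Bdef /Q -mulmxDl -mulmxBl; congr (_ *m _).
  rewrite linearD /= mulmxDl !mulmxDr -[RHS]addrA -opprD; congr (_ - _).
  by rewrite !addrA.
have nB : frob B <= 2 * frob X * frob Sh * frob H.
  rewrite ?Bdef (le_trans (frobM _ _)) // mulrAC ler_wpM2r //.
  rewrite (le_trans (frobD _ _)) //.
  have := frobM X H^T; have := frobM H X^T; rewrite !frob_trmx; lra.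
have nQ : frob Q <= frob H ^+ 2 * frob Sh.
  rewrite (le_trans (frobM _ _)) // ler_wpM2r //.
  by have := frobM H H^T; rewrite frob_trmx.
have nQ' : frob Q <= b * frob Sh * frob H.
  rewrite (le_trans nQ) // mulrAC ler_wpM2r //; nra.
have nBQ : frob (B + Q) ^+ 2 <= ((2 * frob X + b) * frob Sh) ^+ 2 * frob H ^+ 2.
  rewrite -exprMn ler_pXn2r ?nnegrE ?frob_ge0 //.
    by rewrite (le_trans (frobD _ _)) //; lra.
  by rewrite !mulr_ge0 // addr_ge0 ?mulr_ge0 // (le_trans h0).
have nAQ := frob_inner_le A (- Q).
rewrite frobN frob_innerNr in nAQ.
have nAQ' : frob A * frob Q <= frob A * frob Sh * frob H ^+ 2.
  by rewrite -mulrA ler_wpM2l ?frob_ge0 // mulrC.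
rewrite /wfun AE -Adef ![(_ * frob _) ^+ 2]exprMn [frob (A - _) ^+ 2]frob_sqr.
rewrite frob_innerBl !frob_innerBr (frob_innerC _ A) -!frob_sqr frob_innerDr.
rewrite exprMn; have r0 := sqr_ge0 rho.
set W := rho ^+ 2 in r0 *.
have : W * (frob (B + Q) ^+ 2 - 2 * frob_inner A Q) <=
  W * (((2 * frob X + b) * frob Sh) ^+ 2 * frob H ^+ 2
        + 2 * (frob A * frob Sh * frob H ^+ 2)) by rewrite ler_wpM2l //; lra.
lra.
Qed.

(* The gradient need not be computed: a linear form [l] such that
   [wtil (X + H) <= wtil X + l H + O(|H|^2)] is the differential, as one sees by
   using [H] and [- H]. *)
Lemma wtil_smoothing_bounds rho (Sh : 'M[R]_d) b : 0 < rho -> 0 < b ->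
  exists M C : R, [/\ 0 <= M, 0 <= C &
    forall mu G, 0 < mu -> is_egrad (wtil rho Sh mu) G ->
    forall X, stiefel X -> frob (G X) <= M /\
      forall H, frob H <= b -> wtil rho Sh mu (X + H)
        <= wtil rho Sh mu X + frob_inner (G X) H + C / mu * frob H ^+ 2].
Proof.
move=> rho0 b0; pose K : R := Num.sqrt r%:R; pose S := frob Sh.
pose NA : R := (frob (1%:M : 'M[R]_d) + K ^+ 2) * S.
pose Cq := 4 * rho ^+ 2 * (((2 * K + b) * S) ^+ 2 + 2 * NA * S).
have K0 : 0 <= K by exact: sqrtr_ge0.
have S0 : 0 <= S by exact: frob_ge0.
have NA0 : 0 <= NA by rewrite mulr_ge0 // addr_ge0 ?frob_ge0 ?sqr_ge0.
have Cq0 : 0 <= Cq.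
  apply: mulr_ge0; first by rewrite mulr_ge0 ?sqr_ge0.
  by rewrite addr_ge0 ?sqr_ge0 // mulr_ge0 // mulr_ge0.
exists (4 * rho * K * S), (Cq / (2 * rho)); split.
- by rewrite !mulr_ge0 // ltW.
- by rewrite divr_ge0 // mulr_ge0 // ltW.
move=> mu G mu0 gG X XX.
pose A := (1%:M - X *m X^T) *m Sh.
pose B H := (X *m H^T + H *m X^T) *m Sh.
pose w := wfun rho Sh X; pose m := Num.max w (mu * rho).
have w0 : 0 <= w by exact: wfun_ge0.
have c0 : 0 < mu * rho by rewrite mulr_gt0.
have cm : mu * rho <= m by rewrite le_max lexx orbT.
have m0 : 0 < m by exact: lt_le_trans cm.
have wm : w <= m by rewrite le_max lexx.
have XK : frob X = K by exact: frob_stiefel.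
have nA : frob A <= NA.
  rewrite (le_trans (frobM _ _)) // ler_wpM2r // (le_trans (frobB _ _)) //.
  rewrite lerD2l; have := frobM X X^T.
  by rewrite frob_trmx XK.
(* The linear part of [w ^+ 2] times the slope [1 / (2 * m)] of the supporting line. *)
pose l H := - (8 * rho ^+ 2 * frob_inner A (B H)) / (2 * m).
have up H : frob H <= b -> wtil rho Sh mu (X + H)
    <= wtil rho Sh mu X + l H + Cq / (2 * rho) / mu * frob H ^+ 2.
  move=> Hb; rewrite !wtil_huber.
  have := huber_concave c0 w0 (wfun_ge0 Sh (X + H) rho0).
  rewrite -/m => /le_trans; apply; rewrite -addrA lerD2l.
  have h2 : 0 <= frob H ^+ 2 by exact: sqr_ge0.
  have e1 := wfun_sqr_expand rho Hb (erefl A) (erefl (B H)).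
  rewrite XK -/w -/S in e1.
  have e2 : 4 * rho ^+ 2 * (((2 * K + b) * S) ^+ 2 + 2 * frob A * S) * frob H ^+ 2
      <= Cq * frob H ^+ 2.
    rewrite ler_wpM2r // /Cq; apply: ler_wpM2l.
      by rewrite mulr_ge0 ?sqr_ge0.
    by rewrite lerD2l ler_wpM2r // ler_wpM2l.
  have e3 : Cq * frob H ^+ 2 / (2 * m) <= Cq / (2 * rho) / mu * frob H ^+ 2.
    have -> : Cq / (2 * rho) / mu * frob H ^+ 2
        = Cq * frob H ^+ 2 / (2 * (mu * rho)).
      by field; rewrite !lt0r_neq0.
    apply: ler_wpM2l; first by rewrite mulr_ge0.
    by rewrite lef_pV2 ?posrE ?mulr_gt0 // ler_wpM2l.
  apply: le_trans (_ : _ <= (- (8 * rho ^+ 2 * frob_inner A (B H))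
    + Cq * frob H ^+ 2) / (2 * m)) _.
    by rewrite ler_pM2r ?invr_gt0 ?mulr_gt0 //; lra.
  by rewrite mulrDl lerD2l.
have BZ t H : B (t *: H) = t *: B H.
  by rewrite /B linearZ /= -scalemxAr -!scalemxAl -scalerDr -scalemxAl.
have lZ t H : l (t *: H) = t * l H.
  by rewrite /l BZ frob_innerZr; ring.
have Gl H : frob_inner (G X) H <= l H.
  have [dG dE] := gG X.
  have -> : frob_inner (G X) H = 'D_H (wtil rho Sh mu) X by rewrite deriveE // dE.
  have e0 : 0 < b / (frob H + 1).
    by rewrite divr_gt0 // ltr_wpDl ?frob_ge0.
  apply: (derive_le_quad (b := Cq / (2 * rho) / mu * frob H ^+ 2) e0).
    exact: diff_derivable.
  move=> t /andP[t0 tb].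
  have tH : frob (t *: H) <= b.
    rewrite frobZ gtr0_norm //.
    move: tb; rewrite ltr_pdivlMr ?ltr_wpDl ?frob_ge0 //; nra.
  by have := up _ tH; rewrite lZ frobZ gtr0_norm // exprMn; lra.
have GE H : frob_inner (G X) H = l H.
  apply/eqP; rewrite eq_le Gl /=.
  have := Gl (- 1 *: H).
  by rewrite frob_innerZr lZ !mulN1r lerN2.
split; last by move=> H Hb; rewrite GE up.
(* Testing the linear form on [G X] itself; [w <= m] cancels the denominator [m], which makes the
   bound independent of [mu]. *)
have nG : frob (G X) ^+ 2 <= 4 * rho * K * S * frob (G X).
  rewrite frob_sqr GE /l ler_pdivrMr ?mulr_gt0 //.
  have nB : frob (B (G X)) <= 2 * K * S * frob (G X).
    rewrite (le_trans (frobM _ _)) // mulrAC ler_wpM2r //.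
    rewrite (le_trans (frobD _ _)) //.
    have := frobM X (G X)^T; have := frobM (G X) X^T; rewrite !frob_trmx XK; lra.
  have := frob_inner_le A (- B (G X)); rewrite frobN frob_innerNr => h1.
  have h2 : rho * frob A * frob (B (G X)) <= m / 2 * (2 * K * S * frob (G X)).
    apply: ler_pM => //; first by rewrite mulr_ge0 ?frob_ge0 // ltW.
      exact: frob_ge0.
    by have := wm; rewrite /w /wfun -/A; lra.
  have h3 : rho ^+ 2 * - frob_inner A (B (G X)) <= rho * (m / 2 * (2 * K * S * frob (G X))).
    apply: le_trans (_ : rho * (rho * frob A * frob (B (G X))) <= _).
      by rewrite expr2 -!mulrA !ler_pM2l.
    by rewrite ler_pM2l.
  lra.
have [->|g0] := eqVneq (frob (G X)) 0; first by rewrite !mulr_ge0 // ltW.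
by move: nG; rewrite expr2 ler_pM2r // lt_def g0 frob_ge0.
Qed.

End PenaltySmoothing.

(** * Local second-order estimate for retractions *)

Section RetractionTaylor.
Context {R : realType} {d r : nat}.
Local Notation Mat := 'M[R]_(d, r).
Implicit Types (X D E : Mat) (F : Mat * Mat -> Mat) (a : 'I_d) (b : 'I_r).

Lemma section_quotient (V1 V2 W : normedModType R) (F : V1 * V2 -> W) x y v :
  (fun h : R => h^-1 *: (((fun z => F (x, z)) \o shift y) (h *: v) - F (x, y))) =
  (fun h => h^-1 *: ((F \o shift (x, y)) (h *: (0, v)) - F (x, y))).
Proof.
apply/funext => h /=; congr (_ *: (F _ - _)).
by have -> : h *: (0, v) + (x, y) = (h *: (0 : V1) + x, h *: v + y) :> V1 * V2
  by []; rewrite scaler0 add0r.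
Qed.

(** Passes from a map of pairs to the real entries of its restriction to a fibre, on which the mean
    value estimates work. *)
Lemma derivable_section_entry F X D V a b :
  derivable F (X, D) (0, V) ->
  derivable (fun E => F (X, E) a b) D V /\
  'D_V (fun E => F (X, E) a b) D = 'D_(0, V) F (X, D) a b.
Proof.
move=> dF.
have dF1 : derivable (fun E => F (X, E)) D V by rewrite /derivable section_quotient.
have dE : 'D_V (fun E => F (X, E)) D = 'D_(0, V) F (X, D).
  by rewrite /derive section_quotient.
split; first by move/derivable_mxP : dF1 => /(_ a b).
by rewrite -dE derive_mx // mxE.
Qed.

Local Notation I := ('I_d * 'I_r)%type.
Definition entry_dir (i : I) : Mat := delta_mx i.1 i.2.
Definition entry_sum D : R := \sum_(i : I) `|D i.1 i.2|.
Definition entry_bound : R := 1 + #|{: I}|%:R.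
Local Notation N := entry_bound.

Lemma sum_entry_dir D : \sum_(i : I) D i.1 i.2 *: entry_dir i = D.
Proof.
rewrite [RHS]matrix_sum_delta pair_bigA /=.
by apply: eq_bigr => -[].
Qed.

Lemma entry_bound_ge1 : 1 <= N. Proof. by rewrite lerDl. Qed.

Lemma entry_sum_le D M : 0 <= M -> (forall i j, `|D i j| <= M) -> entry_sum D <= N * M.
Proof.
move=> M0 DM; apply: (@le_trans _ _ (\sum_(i : I) M)).
  by apply: ler_sum => i _; exact: DM.
by rewrite sumr_const mulrDl mul1r -[M *+ _]mulr_natl lerDr.
Qed.

Lemma norm_entry_dir i : `|entry_dir i| <= 1.
Proof.
apply: mx_norm_le => // a b; rewrite mxE.
by case: (_ && _); rewrite ?normr1 ?normr0.
Qed.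

Lemma entry_sum_dir D : \sum_(i : I) `|D i.1 i.2| * `|entry_dir i| <= entry_sum D.
Proof. by apply: ler_sum => i _; rewrite ler_piMr // norm_entry_dir. Qed.

(** [partials_expansion] is used twice: on the first partials with reference values 0, then on [F]
    with its partials at 0 as reference values. Each passage from a norm to a sum of entries costs a
    factor [N]; [N ^+ 2 * frob D < e] keeps all intermediate points where the second partials are
    bounded. *)
Lemma section_taylor F X (U : set (Mat * Mat)) e M D a b :
  0 <= M -> smooth_on U F ->
  (forall q : Mat, `|q| < e -> U (X, q) /\ forall i j : I,
    `|Defs.iterD [:: (0, entry_dir j); (0, entry_dir i)] F (X, q)| <= M) ->
  N ^+ 2 * frob D < e ->
  `|F (X, D) a b - F (X, 0) a b
    - \sum_(i : I) D i.1 i.2 * 'D_(0, entry_dir i) F (X, 0) a b|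
  <= M * N ^+ 3 * frob D ^+ 2.
Proof.
move=> M0 [_ sm] Ue De.
have N1 := entry_bound_ge1; have N0 : 0 <= N by lra.
have sumD : entry_sum D <= N * frob D by apply: entry_sum_le => [|i j]; rewrite ?frob_ge0 ?frob_entry.
have D0 := frob_ge0 D.
have sumq (q : Mat) : entry_sum q <= N * `|q| by apply: entry_sum_le => // i j; exact: mx_norm_entry.
have lip (i : I) (q : Mat) : `|q| <= entry_sum D ->
    `|'D_(0, entry_dir i) F (X, q) a b - 'D_(0, entry_dir i) F (X, 0) a b| <= M * (N * entry_sum D).
  move=> qD.
  have qN : entry_sum q <= N * entry_sum D by rewrite (le_trans (sumq q)) // ler_wpM2l.
  have := @partials_expansion R Mat I (index_enum I) (fun i => q i.1 i.2)
    (fun=> 0) entry_dir (fun E => 'D_(0, entry_dir i) F (X, E) a b) 0 M M0.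
  rewrite add0r sum_entry_dir [X in _ - _ - X]big1 => [|? _]; last by rewrite /= mulr0.
  rewrite subr0 => H; apply: le_trans (H _) _; last by rewrite ler_wpM2l.
  move=> j q'; rewrite subr0 => /le_trans /(_ (entry_sum_dir q)) q'q.
  have q'e : `|q'| < e.
    apply: le_lt_trans De; rewrite (le_trans q'q) // (le_trans qN) //.
    by rewrite expr2 -mulrA ler_wpM2l.
  have [Uq Mq] := Ue _ q'e.
  have [_ dF] := sm [:: (0, entry_dir i)] _ Uq.
  have [dg ->] := derivable_section_entry a b (dF (0, entry_dir j)).
  by split=> //; rewrite subr0 (le_trans (mx_norm_entry _ _ _)) // Mq.
have := @partials_expansion R Mat I (index_enum I) (fun i => D i.1 i.2)
    (fun i => 'D_(0, entry_dir i) F (X, 0) a b) entry_dir (fun E => F (X, E) a b) 0 (M * (N * entry_sum D)).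
rewrite add0r sum_entry_dir => H; apply: le_trans (H _ _) _.
- by rewrite !mulr_ge0 // sumr_ge0.
- move=> j q; rewrite subr0 => /le_trans /(_ (entry_sum_dir D)) qD.
  have qe : `|q| < e.
    apply: le_lt_trans De; rewrite (le_trans qD) // (le_trans sumD) //.
    by rewrite ler_wpM2r // expr2 ler_peMr.
  have [Uq Mq] := Ue _ qe.
  have [_ dF] := sm [::] _ Uq.
  have [dg ->] := derivable_section_entry a b (dF (0, entry_dir j)).
  by split=> //; exact: lip.
have -> : M * N ^+ 3 * frob D ^+ 2 = M * (N * (N * frob D)) * (N * frob D) by ring.
have l10 : 0 <= entry_sum D by rewrite sumr_ge0.
rewrite -/(entry_sum D) ler_pM ?mulr_ge0 // ler_wpM2l // ler_wpM2l //.
Qed.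


(** Second partials along the fibre are continuous, hence bounded near [(X0, 0)]; this makes the
    Taylor estimate uniform for base points near [X0]. *)
Lemma retraction_local (Rt : Mat -> Mat -> Mat) X0 : retraction Rt -> stiefel X0 ->
  exists e M : R, [/\ 0 < e, 0 <= M & forall X D, stiefel X -> tangent X D ->
    `|X - X0| < e -> frob D < e -> frob (Rt X D - X - D) <= M * frob D ^+ 2].
Proof.
move=> [[U [TU smU]] [_ [R0 R1]]] X0X0; have [Uo sm] := smU.
pose F (p : Mat * Mat) : Mat := Rt p.1 p.2.
have U0 : U (X0, 0) by apply: TU => //; exact: tangent0.
pose D2 (ij : I * I) := Defs.iterD [:: (0, entry_dir ij.2); (0, entry_dir ij.1)] F.
(* The added 1 leaves room for the variation of each [D2 ij] near [(X0, 0)]. *)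
pose M := \sum_(ij : I * I) `|D2 ij (X0, 0)| + 1.
have M0 : 0 <= M by rewrite addr_ge0 // sumr_ge0.
have nearU : \forall q \near (X0, 0 : Mat), U q /\ forall ij, `|D2 ij q| <= M.
  apply: filterI; first by exact: open_nbhs_nbhs.
  have D2near ij : \forall q \near (X0, 0 : Mat), `|D2 ij q| <= M.
    have [/cvgrPdist_lt /(_ _ ltr01) + _] := sm [:: (0, entry_dir ij.2); (0, entry_dir ij.1)] _ U0.
    apply: filterS => q; rewrite -/F -/(D2 ij) distrC => qlt.
    have aux (x y z w : R) : x < 1 -> y - z <= x -> 0 <= w -> y <= z + w + 1 by lra.
    rewrite /M (bigD1 ij) //=.
    by apply: aux qlt (lerB_dist _ _) _; rewrite sumr_ge0.
  have := filter_forall _ D2near.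
  exact.
have [e0 /= e00 e0P] := (nbhs_normP _ _).1 nearU.
have N1 := entry_bound_ge1; have N0 : 0 < N by lra.
have N20 : 0 < N ^+ 2 by rewrite exprn_gt0.
have N21 : 1 <= N ^+ 2 by rewrite exprn_ege1.
pose e := e0 / N ^+ 2; have e_gt0 : 0 < e by rewrite divr_gt0.
have ee0 : e <= e0 by rewrite ler_pdivrMr // ler_peMr // ltW.
have FE X D a b : `|X - X0| < e0 -> N ^+ 2 * frob D < e0 ->
    `|F (X, D) a b - F (X, 0) a b
      - \sum_(i : I) D i.1 i.2 * 'D_(0, entry_dir i) F (X, 0) a b|
    <= M * N ^+ 3 * frob D ^+ 2.
  move=> XX0; apply: (section_taylor a b M0 smU) => q qe.
  have [|Uq Mq] := e0P (X, q).
    have E : ((X0, 0) : Mat * Mat) - (X, q) = (X0 - X, - q).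
      by apply/pair_equal_spec; split => //=; exact: sub0r.
    rewrite /ball_ /= E prod_normE /= normrN.
    by rewrite gt_max qe distrC XX0.
  split=> // i j; exact: Mq (i, j).
exists e, (M * N ^+ 4); split=> //; first by rewrite mulr_ge0 // exprn_ge0 // ltW.
move=> X D XX XD XX0 De.
have {}XX0 : `|X - X0| < e0 by exact: lt_le_trans ee0.
have {}De : N ^+ 2 * frob D < e0 by rewrite mulrC -ltr_pdivlMr.
have D0 := frob_ge0 D.
(* The linear Taylor term is the derivative along [D], as the estimate at [t *: D] shows, and that
   derivative is [D] because the retraction has identity differential at 0. *)
have K a b : \sum_(i : I) D i.1 i.2 * 'D_(0, entry_dir i) F (X, 0) a b = D a b.
  have dF : derivable F (X, 0) (0, D).
    have UX : U (X, 0) by apply: TU => //; exact: tangent0.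
    by have [_ dF] := sm [::] _ UX; exact: dF.
  have [dg dgE] := derivable_section_entry a b dF.
  have := R1 _ _ XX XD; rewrite -/F => DE.
  rewrite DE in dgE; rewrite -dgE; apply/esym.
  have e1 : 0 < e0 / (N ^+ 2 * (frob D + 1)).
    by rewrite divr_gt0 // mulr_gt0 // ltr_wpDl.
  apply: (derive_eq_quad (b := M * N ^+ 3 * frob D ^+ 2) e1 dg) => t /andP[t0 te].
  rewrite add0r; have := FE X (t *: D) a b XX0.
  rewrite frobZ gtr0_norm //.
  have tD : N ^+ 2 * (t * frob D) < e0.
    move: te; rewrite ltr_pdivlMr; last by rewrite mulr_gt0 // ltr_wpDl.
    have : 0 < t * N ^+ 2 by rewrite mulr_gt0.
    lra.
  move=> /(_ tD); rewrite exprMn mulrCA.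
  congr (`| _ - _ | <= _); rewrite mulr_sumr; apply: eq_bigr => i _.
  by rewrite mxE mulrA.
apply: le_trans (frob_le_sum _) _.
rewrite pair_bigA /=; apply: le_trans (_ : N * (M * N ^+ 3 * frob D ^+ 2) <= _).
  apply: entry_sum_le; first by rewrite !mulr_ge0 ?exprn_ge0 ?sqr_ge0 // ltW.
  move=> a b; have := FE X D a b XX0 De.
  by rewrite K /F /= (R0 _ XX) !mxE.
by rewrite le_eqVlt; apply/orP; left; apply/eqP; ring.
Qed.

End RetractionTaylor.

(** * Compactness of the Stiefel manifold and the uniform retraction estimate *)

Section StiefelCompact.
Context {R : realType} {d r : nat}.
Local Notation Mat := 'M[R]_(d, r).

(** Flattened to row vectors, the manifold is bounded since entries are at most [|X| = sqrt r], and
    closed as an intersection of level sets of continuous functions, the entries of [X^T *m X]. *)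
Lemma stiefel_rV_compact :
  compact [set v : 'rV[R]_(d * r) | stiefel (vec_mx v : Mat)].
Proof.
apply: bounded_closed_compact.
  exists (Num.sqrt r%:R); split; first exact: num_real.
  move=> x rx v /= vS; apply: mx_norm_le.
    exact: le_trans (sqrtr_ge0 _) (ltW rx).
  move=> i k; rewrite ord1; case/mxvec_indexP: k => a b.
  have -> : v 0 (mxvec_index a b) = (vec_mx v : Mat) a b by rewrite mxE.
  by rewrite (le_trans (frob_entry _ _ _)) // frob_stiefel // ltW.
have -> : [set v : 'rV[R]_(d * r) | stiefel (vec_mx v : Mat)] =
    \bigcap_(ij in [set: 'I_r * 'I_r])
      (fun v : 'rV[R]_(d * r) =>
         \sum_k v 0 (mxvec_index k ij.1) * v 0 (mxvec_index k ij.2)) @^-1`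
      [set (ij.1 == ij.2)%:R].
  apply/seteqP; split=> v /=.
    move=> vS [i j] _ /=.
    have /matrixP /(_ i j) := vS; rewrite !mxE => <-.
    by apply: eq_bigr => k _; rewrite !mxE.
  move=> vS; apply/matrixP => i j; have := vS (i, j) I; rewrite /= !mxE => <-.
  by apply: eq_bigr => k _; rewrite !mxE.
apply: closed_bigI => ij _; apply: preimage_closed; last exact: closed_eq.
have C : continuous (fun v : 'rV[R]_(d * r) =>
    \sum_k v 0 (mxvec_index k ij.1) * v 0 (mxvec_index k ij.2)).
  apply: continuous_big; first exact: add_continuous.
  move=> k _ v; apply: cvgM; first exact: (nbhs_filter v).
    exact: coord_continuous.
  exact: coord_continuous.
by move=> v _; exact: C.
Qed.

Lemma retraction_second_order (Rt : Mat -> Mat -> Mat) b : retraction Rt ->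
  exists2 M : R, 0 <= M & forall X D, stiefel X -> tangent X D ->
    frob D <= b -> frob (Rt X D - X - D) <= M * frob D ^+ 2.
Proof.
move=> hRt; have [_ [RS _]] := hRt.
(* One parameter gives both the radius [i^-1] and the constant [i], so the estimate weakens as [i]
   grows and compactness yields a single [i] for all base points. *)
pose P (i : R) (v : 'rV[R]_(d * r)) := forall D, stiefel (vec_mx v : Mat) ->
  tangent (vec_mx v) D -> frob D < i^-1 ->
  frob (Rt (vec_mx v) D - vec_mx v - D) <= i * frob D ^+ 2.
have /compact_near_coveringP /(_ R +oo P) := stiefel_rV_compact.
have near_loc v0 : stiefel (vec_mx v0 : Mat) ->
    \forall v \near v0 & i \near +oo, P i v.
  move=> /(retraction_local hRt) [e [M [e0 M0 eM]]].
  have nb : nbhs v0 [set v | `|v0 - v| < e].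
    by apply: (nbhs_normP (v0 : 'rV[R]_(d * r)) _).2; exists e.
  have ni (x : R) : \forall i \near +oo, x < i by apply: nbhs_pinfty_gt; exact: num_real.
  have ni0 := ni 0; have nie := ni e^-1; have niM := ni M.
  near=> v i; rewrite /P /= => D XX XD Di.
  have i0 : 0 < i by near: i; exact: ni0.
  have iM : M <= i by apply: ltW; near: i; exact: niM.
  have ie : e^-1 < i by near: i; exact: nie.
  have De : frob D < e.
    by apply: lt_trans Di _; rewrite -[ltRHS]invrK ltf_pV2 ?posrE ?invr_gt0.
  have ve : `|v - v0| < e by rewrite distrC; near: v; exact: nb.
  apply: le_trans (eM _ _ XX XD _ De) _; last by rewrite ler_wpM2r ?sqr_ge0.
  apply: le_lt_trans ve; apply: mx_norm_le => // a b0.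
  by rewrite (le_trans _ (mx_norm_entry _ ord0 (mxvec_index a b0))) // !mxE.
move=> /(_ _ near_loc) [M0 [_ M0P]].
pose M := Num.max 1 (M0 + 1).
have M1 : 1 <= M by rewrite le_max lexx.
have M_gt0 : 0 < M by lra.
have PM X D : stiefel X -> tangent X D -> frob D < M^-1 ->
    frob (Rt X D - X - D) <= M * frob D ^+ 2.
  have MM0 : M0 < M by rewrite lt_max ltrDl ltr01 orbT.
  move=> XX XD DM; have := M0P M MM0 (mxvec X); rewrite /= mxvecK.
  by move=> /(_ XX D); rewrite mxvecK => /(_ XX XD DM).
(* Away from the zero section the remainder is bounded because the manifold is. *)
pose K := 2 * Num.sqrt r%:R + `|b|.
have K0 : 0 <= K by rewrite addr_ge0 ?mulr_ge0 ?sqrtr_ge0.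
(* If [frob D >= M^-1] then [M ^+ 2 * frob D ^+ 2 >= 1], so the crude bound [K] is below
   [K * M ^+ 2 * frob D ^+ 2]. *)
exists (M + K * M ^+ 2); first by rewrite addr_ge0 ?mulr_ge0 ?sqr_ge0 // ltW.
move=> X D XX XD Db; rewrite mulrDl.
have D20 := sqr_ge0 (frob D).
have [DM|MD] := ltP (frob D) M^-1.
  by rewrite (le_trans (PM _ _ XX XD DM)) // lerDl mulr_ge0 // mulr_ge0 // sqr_ge0.
have RK : frob (Rt X D - X - D) <= K.
  have := frobB (Rt X D - X) D; have := frobB (Rt X D) X.
  rewrite (frob_stiefel XX) (frob_stiefel (RS _ _ XX XD)) /K.
  have := ler_norm b; lra.
apply: le_trans RK _; rewrite -[leLHS]add0r lerD //.
  by rewrite mulr_ge0 // ltW.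
rewrite -mulrA ler_peMr // -exprMn exprn_ege1 //.
by rewrite -ler_pdivrMl // mulr1.
Unshelve. all: by end_near. Qed.

End StiefelCompact.

(** * Bounds on the objective and acceptance of small steps *)

Section Descent.
Context {R : realType} {d r : nat}.
Local Notation Mat := 'M[R]_(d, r).
Implicit Types (X Y V H : Mat).

Lemma egrad_mvt (F : Mat -> R) (G : Mat -> Mat) X H : is_egrad F G ->
  exists2 t : R, `|t| <= 1 & F (X + H) - F X = frob_inner (G (X + t *: H)) H.
Proof.
move=> FG; have DF Y : derivable F Y H /\ 'D_H F Y = frob_inner (G Y) H.
  have [dF dE] := FG Y; split; first exact: diff_derivable.
  by rewrite deriveE // dE.
have [t t1 tE] := @mvt_line R Mat F X H 1 (fun t _ => (DF _).1).
exists t; first by rewrite normr1 in t1.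
by move: tE; rewrite scale1r mul1r (DF _).2.
Qed.

Section LipschitzGradient.
Variables (u : Mat -> R) (gu : Mat -> Mat) (Lu : R).
Hypothesis hu : is_egrad u gu.
Hypothesis hLu : forall X Y, frob (gu X - gu Y) <= Lu * frob (X - Y).

Let hLu' X Y : frob (gu X - gu Y) <= `|Lu| * frob (X - Y).
Proof. by rewrite (le_trans (hLu _ _)) // ler_wpM2r ?frob_ge0 ?ler_norm. Qed.

(** The mean value theorem replaces the usual integral, whence the constant [|Lu|] rather than its
    half. *)
Lemma egrad_quad_upper X H :
  u (X + H) <= u X + frob_inner (gu X) H + `|Lu| * frob H ^+ 2.
Proof.
have [t t1 tE] := egrad_mvt X H hu.
have h : frob_inner (gu (X + t *: H) - gu X) H <= `|Lu| * frob H ^+ 2.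
  apply: le_trans (frob_inner_le _ _) _; rewrite expr2 mulrA.
  rewrite ler_wpM2r ?frob_ge0 // (le_trans (hLu' _ _)) // ler_wpM2l //.
  by rewrite addrAC subrr add0r frobZ ler_piMl ?frob_ge0.
move: h; rewrite frob_innerBl; lra.
Qed.

Lemma egrad_growth X : frob (gu X) <= frob (gu 0) + `|Lu| * frob X.
Proof.
rewrite -{1}(subrK (gu 0) (gu X)) addrC (le_trans (frobD _ _)) // lerD2l.
by rewrite (le_trans (hLu' _ _)) // subr0.
Qed.

Lemma egrad_bounded K : exists B : R, forall X, frob X <= K -> `|u X| <= B.
Proof.
exists (`|u 0| + (frob (gu 0) + `|Lu| * K) * K) => X XK.
have [t t1] := egrad_mvt 0 X hu; rewrite !add0r => tE.
have -> : u X = u 0 + (u X - u 0) by rewrite addrC subrK.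
rewrite (le_trans (ler_normD _ _)) // lerD2l tE.
apply: le_trans (normr_frob_inner _ _) _; apply: ler_pM; rewrite ?frob_ge0 //.
apply: le_trans (egrad_growth _) _; rewrite lerD2l ler_wpM2l //.
apply: le_trans XK; rewrite frobZ ler_piMl ?frob_ge0 //.
Qed.

End LipschitzGradient.

Lemma lipschitz_fun_norm (s : Mat -> R) Ls X Y : lipschitz_fun s Ls ->
  `|s X - s Y| <= `|Ls| * frob (X - Y).
Proof.
by move=> /(_ X Y) /le_trans; apply; rewrite ler_wpM2r ?frob_ge0 ?ler_norm.
Qed.

Lemma wfun_le rho (Sh : 'M[R]_d) X : 0 < rho ->
  wfun rho Sh X <= 2 * rho * ((frob (1%:M : 'M[R]_d) + frob X ^+ 2) * frob Sh).
Proof.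
move=> rho0; apply: ler_wpM2l; first by rewrite mulr_ge0 // ltW.
rewrite (le_trans (frobM _ _)) // ler_wpM2r ?frob_ge0 //.
rewrite (le_trans (frobB _ _)) // lerD2l (le_trans (frobM _ _)) //.
by rewrite frob_trmx.
Qed.

Variables (u s : Mat -> R) (gu : Mat -> Mat) (Lu Ls : R).
Hypotheses (hu : is_egrad u gu)
  (hLu : forall X Y, frob (gu X - gu Y) <= Lu * frob (X - Y))
  (hsc : convex_fun s) (hsL : lipschitz_fun s Ls).
Variables (rho : R) (Sh : 'M[R]_d) (gw : R -> Mat -> Mat).
Hypotheses (hrho : 0 < rho)
  (hgw : forall mu, 0 < mu -> is_egrad (wtil rho Sh mu) (gw mu)).
Variables (mu0 : R) (Rt : Mat -> Mat -> Mat).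
Hypotheses (hmu0 : 0 < mu0) (hRt : retraction Rt).

Let K : R := Num.sqrt r%:R.

Lemma ftil_bounded : exists2 B : R, 0 <= B & forall X mu, stiefel X ->
  0 < mu <= mu0 -> `|ftil u s rho Sh mu X| <= B.
Proof.
have [Bu BuP] := egrad_bounded hu hLu K.
pose Bw := 2 * rho * ((frob (1%:M : 'M[R]_d) + K ^+ 2) * frob Sh) + mu0 * rho.
pose Bs := `|s 0| + `|Ls| * K.
have aux X mu : stiefel X -> 0 < mu <= mu0 -> `|ftil u s rho Sh mu X| <= Bu + Bw + Bs.
  move=> XX /andP[mu_gt0 mule]; have XK := frob_stiefel XX; rewrite -/K in XK.
  have uB : `|u X| <= Bu by apply: BuP; rewrite XK.
  have sB : `|s X| <= Bs.
    have := lipschitz_fun_norm X 0 hsL; rewrite subr0 XK => h.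
    by rewrite -[s X](subrK (s 0)) addrC (le_trans (ler_normD _ _)) // lerD2l.
  have c0 : 0 < mu * rho by rewrite mulr_gt0.
  have wB : `|wtil rho Sh mu X| <= Bw.
    have w0 := wfun_ge0 Sh X hrho.
    rewrite wtil_huber ger0_norm ?huber_ge0 // (le_trans (huber_upper _ _)) //.
    by rewrite lerD ?ler_pM2r // -XK wfun_le.
  by rewrite (le_trans (ler_normD _ _)) // lerD // (le_trans (ler_normD _ _)) // lerD.
exists `|Bu + Bw + Bs| => // X mu XX muP.
exact: le_trans (aux X mu XX muP) (ler_norm _).
Qed.

(** Ensures that replacing [mu] by [theta * mu] does not raise the objective. *)
Lemma ftil_mono mu mu' X : 0 < mu -> mu <= mu' ->
  ftil u s rho Sh mu X <= ftil u s rho Sh mu' X.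
Proof.
move=> mu_gt0 le_mu; rewrite lerD2r lerD2l !wtil_huber huber_mono ?mulr_gt0 //.
  by rewrite ler_pM2r.
exact: wfun_ge0.
Qed.

(** The convex model decreases by at least [t |V|^2 / mu], twice what the test requires. The
    retraction error, the curvature of [u] and that of the penalty, of order [1 / mu], cost at most
    a constant times [t^2 |V|^2 / mu], which the spare half absorbs for small [t], uniformly in
    [mu]. *)
Lemma linesearch_accepts : exists2 a : R, 0 < a <= 1 &
  forall X V mu, stiefel X -> tangent X V -> 0 < mu <= mu0 ->
  (forall W, tangent X W -> subobj gu gw s X mu V <= subobj gu gw s X mu W) ->
  forall t, 0 < t <= a ->
    ftil u s rho Sh mu (Rt X (t *: V))
      <= ftil u s rho Sh mu X - t / (2 * mu) * frob V ^+ 2.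
Proof.
have K0 : 0 <= K by exact: sqrtr_ge0.
(* Points of the manifold have norm [K], so displacements are at most [2 * K]; the 1 keeps the
   radius positive. *)
have b0 : 0 < 2 * K + 1 by rewrite ltr_wpDl ?mulr_ge0.
have [Mw [Cw [Mw0 Cw0 wP]]] := wtil_smoothing_bounds r Sh hrho b0.
pose Gu := frob (gu 0) + `|Lu| * K.
have Gu0 : 0 <= Gu by rewrite addr_ge0 ?frob_ge0 ?mulr_ge0.
pose G := Gu + Mw + `|Ls|.
have G0 : 0 <= G by rewrite addr_ge0 // addr_ge0.
(* [mu * G] will bound [frob V]; so [B] is the radius for the retraction estimate. *)
pose B := mu0 * G.
have B0 : 0 <= B by rewrite mulr_ge0 // ltW.
have [M M0 MP] := retraction_second_order B hRt.
pose c1 := 1 + M * B.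
have c10 : 0 <= c1 by apply: addr_ge0 => //; exact: mulr_ge0.
(* The errors total at most [t ^+ 2 * Q * frob V ^+ 2 / mu], and [t <= (2 * (Q + 1))^-1] gives
   [t * Q <= 1 / 2]. *)
pose Q := mu0 * (G * M) + (`|Lu| * mu0 + Cw) * c1 ^+ 2.
have Q0 : 0 <= Q.
  have mu0' := ltW hmu0.
  apply: addr_ge0; first by rewrite mulr_ge0 // mulr_ge0.
  by rewrite mulr_ge0 ?sqr_ge0 // addr_ge0 // mulr_ge0.
have Q1 : 0 < 2 * (Q + 1) by rewrite mulr_gt0 // ltr_wpDl.
exists (2 * (Q + 1))^-1.
  rewrite invr_gt0 Q1 invf_le1 //; lra.
move=> X V mu XX XV /andP[mu_gt0 mule] Vmin t /andP[t0 ta].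
have t1 : t <= 1 by rewrite (le_trans ta) // invf_le1 //; lra.
have tQ : t * Q <= 2^-1.
  have : t * (2 * (Q + 1)) <= 1 by rewrite -ler_pdivlMr // mul1r.
  lra.
pose a := gu X + gw mu X.
have XK := frob_stiefel XX; rewrite -/K in XK.
have [gwM wup] := wP mu (gw mu) mu_gt0 (hgw mu_gt0) X XX.
have guG : frob (gu X) <= Gu by rewrite (le_trans (egrad_growth hLu _)) // XK.
have aG : frob a <= Gu + Mw by rewrite (le_trans (frobD _ _)) // lerD.
have v0 := frob_ge0 V.
(* Testing optimality in the direction [- V], back to [X], yields the model decrease
   [frob V ^+ 2 / mu]. *)
have XNV : tangent X (- V) by rewrite -scaleN1r; exact: tangentZ.
have := prox_variational hsc mu_gt0 XV Vmin XNV.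
rewrite addrK -/a frob_innerDl frob_innerZl !frob_innerNr -frob_sqr => opt.
set y := mu^-1 * frob V ^+ 2.
have yE : frob V ^+ 2 = mu * y by rewrite mulrA divff ?mul1r // lt0r_neq0.
have y0 : 0 <= y by rewrite mulr_ge0 ?invr_ge0 ?sqr_ge0 // ltW.
have {}opt : frob_inner a V + (s (X + V) - s X) <= - y by rewrite /y; lra.
have VB : frob V <= B.
  have h1 : - (frob a * frob V) <= frob_inner a V.
    by have := normr_frob_inner a V; rewrite ler_norml => /andP[].
  have h2 : - (`|Ls| * frob V) <= s (X + V) - s X.
    have := lipschitz_fun_norm (X + V) X hsL.
    by rewrite addrAC subrr add0r ler_norml => /andP[].
  have h3 : y <= G * frob V.
    have : frob a * frob V <= (Gu + Mw) * frob V by rewrite ler_wpM2r.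
    rewrite /G; lra.
  have h4 : frob V ^+ 2 <= mu0 * G * frob V.
    rewrite yE -mulrA; apply: ler_pM => //; exact: ltW.
  have [->|vn0] := eqVneq (frob V) 0; first by [].
  by move: h4; rewrite expr2 ler_pM2r // lt_def vn0.
have tVE : frob (t *: V) = t * frob V by rewrite frobZ gtr0_norm.
have tVB : frob (t *: V) <= B by rewrite tVE (le_trans _ VB) // ler_piMl.
have XtV := tangentZ t XV.
have := MP X (t *: V) XX XtV tVB.
set E := Rt X (t *: V) - X - t *: V => EM.
(* The actual displacement: tangent step plus retraction error. *)
pose H := t *: V + E.
have RtE : Rt X (t *: V) = X + H by rewrite /H /E [t *: V + _]addrC subrK [RHS]addrC subrK.
rewrite tVE exprMn in EM.
have t2 : t ^+ 2 * frob V ^+ 2 <= t * frob V * B.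
  rewrite -exprMn expr2; apply: ler_wpM2l; first by rewrite mulr_ge0 // ltW.
  by rewrite -tVE.
have Hc : frob H <= c1 * (t * frob V).
  apply: le_trans (frobD _ _) _; rewrite tVE /c1.
  have : M * (t ^+ 2 * frob V ^+ 2) <= M * (t * frob V * B) by rewrite ler_wpM2l.
  lra.
have H2 : frob H ^+ 2 <= c1 ^+ 2 * (t ^+ 2 * (mu * y)).
  rewrite -yE -exprMn -exprMn ler_pXn2r ?nnegrE ?frob_ge0 //.
  by rewrite mulr_ge0 // mulr_ge0 // ltW.
have Hb : frob H <= 2 * K + 1.
  have [_ [RS _]] := hRt.
  have -> : H = Rt X (t *: V) - X by rewrite RtE addrAC subrr add0r.
  apply: le_trans (frobB _ _) _.
  by rewrite (frob_stiefel (RS _ _ XX XtV)) XK -/K; lra.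
have uH := egrad_quad_upper hu hLu X H.
have wH := wup H Hb.
have sH : s (X + H) <= s (X + t *: V) + `|Ls| * frob E.
  have := lipschitz_fun_norm (X + H) (X + t *: V) hsL.
  have -> : X + H - (X + t *: V) = E by rewrite /H addrA [_ + E]addrC addrK.
  by rewrite ler_norml => /andP[_]; lra.
have sV : s (X + t *: V) <= s X + t * (s (X + V) - s X).
  have := hsc (X + V) X (t := t); rewrite ltW // t1 => /(_ isT).
  have -> : t *: (X + V) + (1 - t) *: X = X + t *: V.
    have tt : t + (1 - t) = 1 by lra.
    by rewrite scalerDr addrAC -scalerDl tt scale1r.
  lra.
have aH : frob_inner a H <= t * frob_inner a V + (Gu + Mw) * frob E.
  rewrite /H frob_innerDr frob_innerZr lerD2l (le_trans (frob_inner_le _ _)) //.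
  by rewrite ler_wpM2r ?frob_ge0.
have E2 : G * frob E <= G * (M * (t ^+ 2 * (mu0 * y))).
  apply: ler_wpM2l => //; apply: le_trans EM _; rewrite yE.
  by apply: ler_wpM2l => //; rewrite ler_wpM2l ?sqr_ge0 // ler_wpM2r.
have L2 : `|Lu| * frob H ^+ 2 <= `|Lu| * (c1 ^+ 2 * (t ^+ 2 * (mu0 * y))).
  apply: ler_wpM2l => //; apply: le_trans H2 _.
  by rewrite ler_wpM2l ?sqr_ge0 // ler_wpM2l ?sqr_ge0 // ler_wpM2r.
have C2 : Cw / mu * frob H ^+ 2 <= Cw * (c1 ^+ 2 * (t ^+ 2 * y)).
  have -> : Cw * (c1 ^+ 2 * (t ^+ 2 * y)) = Cw / mu * (c1 ^+ 2 * (t ^+ 2 * (mu * y))).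
    by field; exact: lt0r_neq0.
  by apply: ler_wpM2l => //; rewrite divr_ge0 // ltW.
have tot : t * (t * Q * y) <= t * (2^-1 * y).
  by rewrite ler_pM2l // ler_wpM2r.
have tE2 : t * (t * Q * y) = G * (M * (t ^+ 2 * (mu0 * y)))
   + `|Lu| * (c1 ^+ 2 * (t ^+ 2 * (mu0 * y))) + Cw * (c1 ^+ 2 * (t ^+ 2 * y)).
  by rewrite /Q; ring.
have -> : t / (2 * mu) * frob V ^+ 2 = t * (2^-1 * y).
  by rewrite /y; field; exact: lt0r_neq0.
have topt : t * (frob_inner a V + (s (X + V) - s X)) <= t * - y by rewrite ler_pM2l.
rewrite RtE /ftil; rewrite /a frob_innerDl in aH; rewrite /a in topt.
move: uH wH sH sV aH E2 L2 C2 tot topt; rewrite tE2 /G.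
lra.
Qed.

End Descent.

(** * Iteration count and certificate of stationarity *)

Unset Implicit Arguments.

Theorem mainTheorem13 (R : realType) (d r : nat) (hr1 : (1 <= r)%N) (hrd : (r < d)%N)
  (u : 'M[R]_(d, r) -> R) (gu : 'M[R]_(d, r) -> 'M[R]_(d, r)) (Lu : R)
  (hu : is_egrad u gu)
  (hLu : forall X Y, frob (gu X - gu Y) <= Lu * frob (X - Y))
  (s : 'M[R]_(d, r) -> R) (Ls : R)
  (hsc : convex_fun s) (hsL : lipschitz_fun s Ls)
  (rho : R) (Sh : 'M[R]_d) (hrho : 0 < rho) (hSh : psd Sh)
  (gw : R -> 'M[R]_(d, r) -> 'M[R]_(d, r))
  (hgw : forall mu, 0 < mu -> is_egrad (wtil rho Sh mu) (gw mu))
  (mu0 theta beta : R) (hmu0 : 0 < mu0) (htheta : 0 < theta < 1) (hbeta : 0 < beta < 1)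
  (Rt : 'M[R]_(d, r) -> 'M[R]_(d, r) -> 'M[R]_(d, r)) (hRt : retraction Rt) :
  exists C : R, 0 < C /\
    forall eps : R, 0 < eps < 1 -> eps <= mu0 ->
    forall (X V : nat -> 'M[R]_(d, r)) (mus : nat -> R),
      smpg_run u gu s rho Sh gw mu0 theta beta Rt X V mus ->
      (exists k : nat, frob (V k) <= mus k ^+ 2 /\ k%:R <= C * eps ^- 3 /\ mus k <= eps) /\
      (forall k : nat, frob (V k) <= mus k ^+ 2 -> k%:R <= C * eps ^- 3 -> mus k <= eps ->
         frob (V k) <= eps ^+ 2 /\
         eps_stat_cert gu gw s eps (X k) (V k) (mus k) /\
         eps_stationary gu gw s eps (X k)).
Proof.
have [th0 th1] := andP htheta; have [be0 be1] := andP hbeta.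
have [_ [RS _]] := hRt.
have [B B0 BP] := ftil_bounded hu hLu hsL Sh hrho mu0.
have [a /andP[a0 a1] aP] :=
  linesearch_accepts hu hLu hsc hsL hrho hgw hmu0 hRt.
(* Loss per iteration in units of [eps ^+ 3]: the first term serves when [mus] shrinks, the second
   when it is kept. *)
pose c := Num.min (1 - theta) (beta * a * theta ^+ 3 / 2).
have ba0 : 0 < beta * a by rewrite mulr_gt0.
have c0 : 0 < c by rewrite lt_min subr_gt0 th1 divr_gt0 // mulr_gt0 // exprn_gt0.
(* The potential stays in an interval of length [2 * B + mu0]. *)
exists ((2 * B + mu0) / c); split.
  by rewrite divr_gt0 // ltr_wpDl // mulr_ge0.
move=> eps /andP[e0 e1] emu0 X V mus [X0 [m0 run]].
have inv k : stiefel (X k) /\ 0 < mus k <= mu0.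
  elim: k => [|k [XX /andP[mk0 mk1]]]; first by rewrite m0 hmu0 lexx.
  have [[TV _] [[m [_ [_ ->]]] ->]] := run k; split.
    by apply: RS => //; exact: tangentZ.
  case: ifP => _; first by rewrite mk0.
  rewrite mulr_gt0 //= (le_trans _ mk1) // ler_piMl // ltW //.
have desc k : ftil u s rho Sh (mus k) (X k.+1)
    <= ftil u s rho Sh (mus k) (X k) - beta * a / (2 * mus k) * frob (V k) ^+ 2.
  have [XX mk] := inv k; have [mk0 _] := andP mk.
  have [[TV Vmin] [[m [lc [nlc ->]]] _]] := run k.
  apply: le_trans lc _; rewrite lerD2l lerN2.
  apply: ler_wpM2r; first exact: sqr_ge0.
  apply: ler_wpM2r; first by rewrite invr_ge0 mulr_ge0 // ltW.
  (* Either the full step is taken, and [beta * a <= 1], or the previous trial was rejected and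
     hence exceeds [a]. *)
  case: m nlc => [|m] nlc.
    by rewrite expr0 -[leRHS]mulr1; apply: ler_pM => //; exact: ltW.
  rewrite exprS ler_pM2l // leNgt; apply/negP => bma.
  apply: (nlc m) => //; apply: aP => //.
  by rewrite exprn_gt0 // ltW.
have step k (P := fun k => ftil u s rho Sh (mus k) (X k) + mus k) :
    theta * eps <= mus k -> ~ (frob (V k) <= mus k ^+ 2 /\ mus k <= eps) ->
    theta * eps <= mus k.+1 /\ P k.+1 <= P k - c * eps ^+ 3.
  move=> mk_ge nK; rewrite /P.
  have [XX mk] := inv k; have [mk0 mk1] := andP mk.
  have [XX' _] := inv k.+1.
  have [_ [_ ->]] := run k; have dk := desc k.
  have e30 : 0 <= eps ^+ 3 by rewrite exprn_ge0 // ltW.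
  (* If [mus] is kept, [frob (V k) > mus k ^+ 2] gives a decrease of at least
     [beta * a / 2 * mus k ^+ 3], with [mus k >= theta * eps]. If it shrinks, [mus k > eps]: the new
     value stays above [theta * eps], and the summand [mus] alone loses [(1 - theta) * mus k]. *)
  have [Vbig|Vsmall] := ltP (mus k ^+ 2) (frob (V k)); split => //.
  - suff : c * eps ^+ 3 <= beta * a / (2 * mus k) * frob (V k) ^+ 2 by lra.
    apply: le_trans (_ : beta * a * theta ^+ 3 / 2 * eps ^+ 3 <= _).
      by rewrite ler_wpM2r // ge_min lexx orbT.
    apply: le_trans (_ : beta * a / (2 * mus k) * (mus k ^+ 2) ^+ 2 <= _).
      have -> : beta * a / (2 * mus k) * (mus k ^+ 2) ^+ 2 = beta * a / 2 * mus k ^+ 3.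
        by field; exact: lt0r_neq0.
      have -> : beta * a * theta ^+ 3 / 2 * eps ^+ 3 = beta * a / 2 * (theta * eps) ^+ 3.
        by ring.
      rewrite ler_wpM2l ?divr_ge0 ?(ltW ba0) // lerXn2r ?nnegrE // ltW //.
      by rewrite mulr_gt0.
    rewrite ler_wpM2l ?divr_ge0 ?(ltW ba0) ?mulr_ge0 ?(ltW mk0) //.
    by rewrite lerXn2r ?nnegrE ?sqr_ge0 ?frob_ge0 // ltW.
  - have em : eps < mus k by rewrite ltNge; apply/negP => ?; exact: nK.
    by rewrite ler_wpM2l // ltW.
  - have em : eps < mus k by rewrite ltNge; apply/negP => ?; exact: nK.
    have tm0 : 0 < theta * mus k by rewrite mulr_gt0.
    have tm1 : theta * mus k <= mus k by rewrite ler_piMl // ltW.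
    have mono := ftil_mono u s Sh hrho (X k.+1) tm0 tm1.
    have q0 : 0 <= beta * a / (2 * mus k) * frob (V k) ^+ 2.
      by rewrite mulr_ge0 ?sqr_ge0 // divr_ge0 ?(ltW ba0) // mulr_ge0 // ltW.
    have e3 : eps ^+ 3 <= eps by rewrite exprS ler_piMr ?exprn_ile1 // ltW.
    have ce : c * eps ^+ 3 <= (1 - theta) * mus k.
      apply: ler_pM => //; first exact: ltW.
        by rewrite ge_min lexx.
      exact: le_trans e3 (ltW em).
    lra.
(* Adding [mus k] to the objective makes every iteration lose at least
   [c * eps ^+ 3], whether or not [mus] shrinks. *)
pose Phi k := ftil u s rho Sh (mus k) (X k) + mus k.
have PhiB k : - B <= Phi k <= B + mu0.
  have [XX mk] := inv k; have [mk0 mk1] := andP mk.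
  by have := BP _ _ XX mk; rewrite ler_norml /Phi => /andP[? ?]; apply/andP; lra.
have e3_gt0 : 0 < eps ^+ 3 by rewrite exprn_gt0.
split.
  apply: contrapT => nex; set T := (2 * B + mu0) / c * eps ^- 3 in nex.
  have T0 : 0 <= T.
    by rewrite mulr_ge0 ?invr_ge0 ?(ltW e3_gt0) // divr_ge0 ?(ltW c0) // addr_ge0 ?mulr_ge0 // ltW.
  (* The indices [0, ..., n] are all at most [T]; were none of them suitable, there would be
     [n.+1 > T] losses, more than the range of the potential allows. *)
  pose n := Num.truncn T.
  have [nT Tn] : n%:R <= T /\ T < n.+1%:R.
    by have /andP := truncn_itv T0.
  have decr k : (k <= n.+1)%N ->
      theta * eps <= mus k /\ Phi k <= Phi 0%N - k%:R * (c * eps ^+ 3).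
    elim: k => [_|k IH kn].
      rewrite m0 mul0r subr0 lexx; split=> //.
      by rewrite (le_trans _ emu0) // ler_piMl // ltW.
    have [mk Pk] := IH (ltnW kn).
    have [|mk' Pk'] := step k mk.
      move=> [VK mke]; apply: nex; exists k; do 2!split=> //.
      by rewrite (le_trans _ nT) // ler_nat.
    split=> //; rewrite -natr1 mulrDl mul1r; rewrite -/(Phi _) -/(Phi _) in Pk'.
    by move: Pk Pk'; rewrite /Phi; lra.
  have [_ Pn] := decr n.+1 (leqnn _).
  have /andP[_ P0] := PhiB 0%N; have /andP[Pn1 _] := PhiB n.+1.
  have : n.+1%:R * (c * eps ^+ 3) <= 2 * B + mu0 by lra.
  rewrite -ler_pdivlMr ?mulr_gt0 // invfM mulrA -/T; lra.
move=> k VK _ mke; have [XX /andP[mk0 mk1]] := inv k.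
have [[TV Vmin] _] := run k.
have V2 : frob (V k) <= eps ^+ 2 by rewrite (le_trans VK) // lerXn2r ?nnegrE // ltW.
have cert : eps_stat_cert gu gw s eps (X k) (V k) (mus k).
  split=> //; split; first by rewrite (le_trans V2) // expr2 ler_piMl // ltW.
  split; first by rewrite mk0.
  have [G sG GE] := prox_subgradient hsc mk0 XX TV Vmin.
  set Z := projT (X k) (gu (X k)) + projT (X k) (gw (mus k) (X k)) + projT (X k) G.
  have ZE : Z = - ((mus k)^-1 *: V k).
    rewrite -GE /Z; congr (_ + _).
    have := projT_is_linear (X k) 1 (gu (X k)) (gw (mus k) (X k)).
    by rewrite !scale1r.
  (* [dist0] is an infimum of nonnegative numbers, so the one element [Z], of norm
     [frob (V k) / mus k <= mus k], bounds it. *)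
  apply: le_trans (_ : frob Z <= _).
    apply: ge_inf; first by exists 0 => _ [Y _ <-]; exact: frob_ge0.
    by exists Z => //; exists G.
  rewrite ZE frobN frobZ ger0_norm ?invr_ge0 ?(ltW mk0) //.
  rewrite mulrC ler_pdivrMr // (le_trans VK) // expr2 ler_wpM2r // ltW //.
by split=> //; split=> //; split=> //; exists (V k), (mus k).
Qed.
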